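(* Let $T$ be a lush hedge of height $H\ge2$ and let $A\in\mathcal R(T)$ have a critical multiplicity list, witnessed by distinct reals $\alpha_1,\alpha_2,\beta_2,\beta_3,\beta_4$. Then $A\in\mathcal{PH}(C^{\Lambda}_{H+1},T)$ for some $\Lambda\in\mathcal B$, and $$\sigma(A)=\bigcup_{i=1}^{H+1}\ell_i(T)\,\sigma(C^{\Lambda}_i),$$ so the whole spectrum of $A$ is determined by $\Lambda$ (and $T$). Moreover $\mathrm{mult}(\alpha_j,A)=\sum_{i\ge j,\ i\equiv j\ (\mathrm{mod}\ 2)}\ell_i(T)$ for $j=1,2$. In particular all of this applies to $A\in\mathcal S(T)$.
   Context: Hedges: a rooted tree has a distinguished root; $y$ is a child of adjacent $z$ if the root-to-$y$ path passes through $z$; a leaf is a non-root vertex of degree 1 (in $P_1$ the single vertex is root and leaf). A hedge is a rooted tree that is $P_1$ or in which all leaves are at equal distance from the root. $\mathrm h(u)$ is the distance from $u$ to a nearest leaf; the height of the hedge is that of its root; $V_i(T)$ is the set of vertices of height $i$; $\ell_i(T)=|V_{i-1}(T)|-|V_i(T)|$ for $i\ge1$. A hedge is lush if every vertex of height $\ge2$ has at least three children and every vertex of height $1$ at least two. $P_n$ is the path $1-\cdots-n$ rooted at $1$. $\mathcal R(T)$: real matrices indexed by $V(T)$ with $a_{ij}\neq0$ iff $\{i,j\}\in E(T)$ ($i\ne j$), $a_{ij}a_{ji}>0$ on edges, arbitrary diagonal; $\mathcal S(T)$ its symmetric members. Multiset union adds multiplicities; $s\Lambda$ multiplies multiplicities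 by $s$. Path-to-hedge: for $C=(c_{ij})\in\mathcal R(P_{H+1})$ and $v\in V(T)$ put $v'=H+1-\mathrm h(v)$; $\mathcal{PH}(C,T)$ is the set of $A\in\mathcal R(T)$ with $a_{vv}=c_{v'v'}$ for all $v$ and $\sum_{u\text{ child of }v}a_{vu}a_{uv}=c_{v',v'+1}c_{v'+1,v'}$ for every non-leaf $v$. $\mathcal B$ is the set of $(\alpha_1,\alpha_2,\beta_2,\beta_3,\beta_4)\in\mathbb R^5$ with distinct entries satisfying one of: $\beta_2<\alpha_1<\alpha_2<\beta_3<\beta_4$; $\beta_2<\beta_4<\alpha_1<\alpha_2<\beta_3$; $\beta_4<\beta_2<\alpha_1<\alpha_2<\beta_3$ and $\alpha_2+\beta_2>\beta_4+\beta_3$; $\beta_3<\beta_2<\alpha_1<\alpha_2<\beta_4$ and $\alpha_2+\beta_2<\beta_4+\beta_3$; $\beta_3<\beta_2<\beta_4<\alpha_1<\alpha_2$; $\beta_4<\beta_3<\beta_2<\alpha_1<\alpha_2$; $\beta_4<\beta_3<\alpha_2<\alpha_1<\beta_2$; $\beta_3<\alpha_2<\alpha_1<\beta_4<\beta_2$; $\beta_3<\alpha_2<\alpha_1<\beta_2<\beta_4$ and $\alpha_2+\beta_2<\beta_4+\beta_3$; $\beta_4<\alpha_2<\alpha_1<\beta_2<\beta_3$ and $\alpha_2+\beta_2>\beta_4+\beta_3$; $\alpha_2<\alpha_1<\beta_4<\beta_2<\beta_3$; $\alpha_2<\alpha_1<\beta_2<\beta_3<\beta_4$. For $\Lambda\in\mathcal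 B$, $C^{\Lambda}_n$ is the $n\times n$ tridiagonal matrix with diagonal $(a_n,\dots,a_1)$, superdiagonal $(b_n,\dots,b_2)$, subdiagonal all $1$, where $a_i=\alpha_1$ ($i$ odd), $a_2=-\alpha_1+\alpha_2+\beta_2$, $a_i=\alpha_2$ ($i>2$ even), $b_2=(\beta_2-\alpha_1)(\alpha_1-\alpha_2)$, $b_3=(\beta_3-\alpha_2)(\beta_3-\beta_2)$, $b_4=\frac{(\beta_4-\alpha_1)(\beta_3-\beta_4)(\alpha_2+\beta_2-\beta_3-\beta_4)}{\beta_4-\beta_2}$, $b_i=(\beta_j-\alpha_1)(\beta_j-\alpha_2)$ for $i>4$, $j\in\{2,3,4\}$, $i\equiv j\pmod 3$. Note $C^\Lambda_i$ is the trailing $i\times i$ principal submatrix of $C^\Lambda_{n}$ for $i\le n$. Critical multiplicity list: $A\in\mathcal R(T)$ has one if there exist five distinct reals $\alpha_1,\alpha_2,\beta_2,\beta_3,\beta_4$ (witnesses) with $\mathrm{mult}(\alpha_j,A)\ge\sum_{i\ge j,\ i\equiv j\ (2)}\ell_i(T)$ ($j=1,2$), $\mathrm{mult}(\beta_j,A)\ge\sum_{i\ge j,\ i\equiv j\ (3)}\ell_i(T)$ ($j=2,3,4$), and $\mathrm{mult}(\beta_4,A)<\ell_3(T)$ (multiplicity $0$ allowed). *)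

(* Defs.v *)
From mathcomp Require Import all_boot all_order all_algebra.
From mathcomp Require Import reals.
Set Implicit Arguments. Unset Strict Implicit. Unset Printing Implicit Defensive.
Import Order.TTheory GRing.Theory Num.Theory.
Local Open Scope ring_scope.

Section Graphs.
Variable n : nat.
Variable adj : rel 'I_n.

Definition simple_graph : Prop :=
  (forall x y, adj x y = adj y x) /\ (forall x, ~~ adj x x).

Definition n_edges : nat := #|[set p : 'I_n * 'I_n | adj p.1 p.2 && (p.1 < p.2)%N]|.

Definition is_tree : Prop :=
  [/\ (0 < n)%N, simple_graph, (forall x y, connect adj x y) & n_edges = n.-1].

Fixpoint ball (x : 'I_n) (k : nat) : {set 'I_n} :=
  if k is k'.+1 then
    ball x k' :|: [set y | [exists z in ball x k', adj z y]]
  else [set x].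

(* graph distance (for a connected graph on n vertices it is < n) *)
Definition dist (x y : 'I_n) : nat := find (fun k => y \in ball x k) (iota 0 n).

Definition deg (v : 'I_n) : nat := #|[set u | adj v u]|.

Section Rooted.
Variable r : 'I_n.

Definition is_leaf (v : 'I_n) : bool := ((v != r) && (deg v == 1%N)) || (n == 1%N).

Definition on_root_path (z y : 'I_n) : bool := (dist r z + dist z y == dist r y)%N.

Definition is_child (z y : 'I_n) : bool := adj z y && on_root_path z y.

Definition children (z : 'I_n) : {set 'I_n} := [set y | is_child z y].

Definition is_hedge : Prop :=
  is_tree /\ (n = 1%N \/ exists d, forall v, is_leaf v -> dist r v = d).

Definition hgt (u : 'I_n) : nat := \big[minn/n]_(v | is_leaf v) dist u v.

Definition height : nat := hgt r.

Definition Vset (i : nat) : {set 'I_n} := [set v | hgt v == i].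

(* l_i(T) = |V_{i-1}| - |V_i|, i >= 1 (nonnegative for hedges) *)
Definition ell (i : nat) : nat := (#|Vset i.-1| - #|Vset i|)%N.

Definition is_lush : Prop :=
  is_hedge /\
  forall v, ((2 <= hgt v)%N -> (3 <= #|children v|)%N) /\
            (hgt v = 1%N -> (2 <= #|children v|)%N).

End Rooted.
End Graphs.

Definition path_adj (m : nat) : rel 'I_m :=
  fun i j => (i.+1 == j :> nat) || (j.+1 == i :> nat).

Section Mat.
Variable R : realType.

Definition inRG (n : nat) (adj : rel 'I_n) (A : 'M[R]_n) : Prop :=
  (forall i j, i != j -> (A i j != 0 <-> adj i j)) /\
  (forall i j, adj i j -> 0 < A i j * A j i).

Definition inSG (n : nat) (adj : rel 'I_n) (A : 'M[R]_n) : Prop :=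
  inRG adj A /\ A^T = A.

Definition mult (n : nat) (x : R) (A : 'M[R]_n) : nat := mup x (char_poly A).

(* Path-to-hedge: A \in PH(C, T), with C \in R(P_{H+1}), H = height of T.
   Indices are 0-based: the 1-based index v' = H+1-h(v) becomes H - h(v). *)
Definition inPH (n : nat) (adj : rel 'I_n) (r : 'I_n) (H : nat)
    (C : 'M[R]_H.+1) (A : 'M[R]_n) : Prop :=
  [/\ H = height adj r,
      inRG (@path_adj H.+1) C,
      inRG adj A,
      (forall v : 'I_n, A v v = C (inord (H - hgt adj r v)) (inord (H - hgt adj r v)))
    & (forall v : 'I_n, ~~ is_leaf adj r v ->
         \sum_(u | is_child adj r v u) A v u * A u v =
         C (inord (H - hgt adj r v)) (inord (H - hgt adj r v).+1) *
         C (inord (H - hgt adj r v).+1) (inord (H - hgt adj r v)))].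

Definition inB (a1 a2 b2 b3 b4 : R) : Prop :=
  uniq [:: a1; a2; b2; b3; b4] /\
  (  (b2 < a1 /\ a1 < a2 /\ a2 < b3 /\ b3 < b4)
  \/ (b2 < b4 /\ b4 < a1 /\ a1 < a2 /\ a2 < b3)
  \/ (b4 < b2 /\ b2 < a1 /\ a1 < a2 /\ a2 < b3 /\ a2 + b2 > b4 + b3)
  \/ (b3 < b2 /\ b2 < a1 /\ a1 < a2 /\ a2 < b4 /\ a2 + b2 < b4 + b3)
  \/ (b3 < b2 /\ b2 < b4 /\ b4 < a1 /\ a1 < a2)
  \/ (b4 < b3 /\ b3 < b2 /\ b2 < a1 /\ a1 < a2)
  \/ (b4 < b3 /\ b3 < a2 /\ a2 < a1 /\ a1 < b2)
  \/ (b3 < a2 /\ a2 < a1 /\ a1 < b4 /\ b4 < b2)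
  \/ (b3 < a2 /\ a2 < a1 /\ a1 < b2 /\ b2 < b4 /\ a2 + b2 < b4 + b3)
  \/ (b4 < a2 /\ a2 < a1 /\ a1 < b2 /\ b2 < b3 /\ a2 + b2 > b4 + b3)
  \/ (a2 < a1 /\ a1 < b4 /\ b4 < b2 /\ b2 < b3)
  \/ (a2 < a1 /\ a1 < b2 /\ b2 < b3 /\ b3 < b4)).

(* entries a_i, b_i of C^Lambda (1-based indices as in the paper) *)
Definition Ca (a1 a2 b2 b3 b4 : R) (i : nat) : R :=
  if odd i then a1
  else if i == 2%N then - a1 + a2 + b2
  else a2.

Definition Cb (a1 a2 b2 b3 b4 : R) (i : nat) : R :=
  if i == 2%N then (b2 - a1) * (a1 - a2)
  else if i == 3%N then (b3 - a2) * (b3 - b2)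
  else if i == 4%N then (b4 - a1) * (b3 - b4) * (a2 + b2 - b3 - b4) / (b4 - b2)
  else
    let bj := match (i %% 3)%N with 2 => b2 | 0 => b3 | _ => b4 end in
    (bj - a1) * (bj - a2).

Definition Cmx (a1 a2 b2 b3 b4 : R) (m : nat) : 'M[R]_m :=
  \matrix_(k < m, l < m)
    if k == l :> nat then Ca a1 a2 b2 b3 b4 (m - k)
    else if k.+1 == l :> nat then Cb a1 a2 b2 b3 b4 (m - k)
    else if l.+1 == k :> nat then 1
    else 0.

Definition ell_sum (n : nat) (adj : rel 'I_n) (r : 'I_n) (j p : nat) : nat :=
  (\sum_(j <= i < n.+2 | i %% p == j %% p) ell adj r i)%N.

Definition critical_witness (n : nat) (adj : rel 'I_n) (r : 'I_n) (A : 'M[R]_n)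
    (a1 a2 b2 b3 b4 : R) : Prop :=
  [/\ uniq [:: a1; a2; b2; b3; b4],
      (ell_sum adj r 1 2 <= mult a1 A)%N,
      (ell_sum adj r 2 2 <= mult a2 A)%N,
      [/\ (ell_sum adj r 2 3 <= mult b2 A)%N,
          (ell_sum adj r 3 3 <= mult b3 A)%N
        & (ell_sum adj r 4 3 <= mult b4 A)%N]
    & (mult b4 A < ell adj r 3)%N].

End Mat.

(* Main.v *)
Require Import Defs.
From mathcomp Require Import all_boot all_order all_algebra.
From mathcomp Require Import fingroup perm reals.
From mathcomp Require Import ring lra zify.
Import Order.TTheory GRing.Theory Num.Theory.
Set Implicit Arguments. Unset Strict Implicit. Unset Printing Implicit Defensive.
Local Open Scope ring_scope.

(**
Fix t and compute, from the leaves up, the diagonal entries of an elimination of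
t - A: f_v = t - a_vv - sum over the children u of a_vu a_uv / f_u, which is
infinite as soon as some child has the value 0. Over the rational functions the
product of the f_v is the characteristic polynomial, and since every f_v is locally
a Nevanlinna function its zeros and poles are simple; hence the multiplicity of t
is the number of zeros minus the number of poles among the f_v(t).

A zero is thus paid for by a pole at its parent, and in a lush hedge the best
arrangement of zeros is unique. This is proved by giving each vertex a penalty
that depends on its height and on its being a zero, a pole or neither, such that
gain + penalty <= (gain of the optimal pattern) + (penalties of the children);
summing over the vertices telescopes. For alpha_1 and alpha_2 the optimal pattern
has period 2 in the height, and it fixes the diagonal of A above height 1. For
another t, a zero of height at least 2 needs a child that is neither a zero nor a
pole, and the optimal pattern has period 3. The values beta_2, beta_3, beta_4 then
fix the remaining diagonal entries and all the sums of a_vu a_uv over the children,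
where mult(beta_4) < l_3 excludes that beta_4 vanishes at height 2. The region B
expresses the positivity of b_2, b_3, b_4; for height 2 the entry b_4 does not
occur and beta_4 has to be replaced by a value that lies in the region.
*)

(** * Determinants of tree-structured matrices *)

(** Only the identity contributes: a permutation that meets nonzero entries only raises [d] at every
    point it moves, yet it preserves the sum of [d]. *)
Lemma det_ranked (K : comNzRingType) (n : nat) (d : 'I_n -> nat) (B : 'M[K]_n) :
  (forall x y, B x y != 0 -> x != y -> (d x < d y)%N) ->
  \det B = \prod_x B x x.
Proof.
move=> Bd; rewrite /determinant (bigD1 (1%g : {perm 'I_n})) //= odd_perm1 expr0 mul1r.
rewrite [X in _ + X]big1 ?addr0; first by apply: eq_bigr => x _; rewrite perm1.
move=> s s1; have [/forallP Bs|] := boolP [forall x, B x (s x) != 0]; last first.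
  rewrite negb_forall => /existsP[x /negPn/eqP Bx].
  by rewrite (bigD1 x) //= Bx mul0r mulr0.
have le_d x : (d x <= d (s x))%N.
  have [<-//|ne] := eqVneq x (s x); exact/ltnW/Bd.
have eq_sum : (\sum_x d x = \sum_x d (s x))%N.
  by rewrite (reindex_inj (@perm_inj _ s)).
case/eqP: s1; apply/permP => x; rewrite perm1; apply/eqP.
case: (boolP (s x == x)) => // ne.
have lt : (d x < d (s x))%N by apply: Bd (Bs x) _; rewrite eq_sym.
suff : (\sum_x d x < \sum_x d (s x))%N by rewrite eq_sum ltnn.
rewrite (bigD1 x) // [X in (_ < X)%N](bigD1 x) //= -addSn.
by apply: leq_add => //; apply: leq_sum.
Qed.

(* Elimination from the leaves upwards: M = L D U, where L and U are supported
   on the diagonal and the parent-child positions, and D carries the F x. *)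
Lemma det_forest (K : fieldType) (n : nat) (child : rel 'I_n) (d : 'I_n -> nat)
    (M : 'M[K]_n) (F : 'I_n -> K) :
  (forall x y, child x y -> (d x < d y)%N) ->
  (forall x y z, child x z -> child y z -> x = y) ->
  (forall x y, x != y -> ~~ child x y -> ~~ child y x -> M x y = 0) ->
  (forall x, F x != 0) ->
  (forall x, F x = M x x - \sum_(u | child x u) M x u * M u x / F u) ->
  \det M = \prod_x F x.
Proof.
move=> cd cU M0 F0 FE.
have cI x : child x x = false by apply/negP => /cd; rewrite ltnn.
have cA x y : child x y -> child y x = false.
  by move=> /cd xy; apply/negP => /cd; rewrite ltnNge ltnW.
pose L := \matrix_(x, y) (if x == y then 1 else if child x y then M x y / F y else 0).
pose U := \matrix_(x, y) (if x == y then 1 else if child y x then M x y / F x else 0).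
pose D := diag_mx (\row_x F x).
have dL : \det L = 1.
  rewrite (det_ranked (d := d)) => [|x y]; first by apply: big1 => x _; rewrite mxE eqxx.
  rewrite mxE => /[swap] /negPf->; case: ifP => [/cd//|]; by rewrite eqxx.
have dU : \det U = 1.
  rewrite -det_tr (det_ranked (d := d)) => [|x y].
    by apply: big1 => x _; rewrite !mxE eqxx.
  rewrite !mxE (eq_sym y x) => /[swap] /negPf->; case: ifP => [/cd//|]; by rewrite eqxx.
suff -> : M = L *m D *m U.
  by rewrite !det_mulmx dL dU mul1r mulr1 det_diag; apply: eq_bigr => x _; rewrite mxE.
(* A term [j] survives only if it is [x] or a child of [x], and also [y] or a child of [y]; distinct
   [x] and [y] have no common child. *)
apply/matrixP => x y; rewrite mxE.
under eq_bigr => j _ do rewrite mul_mx_diag !mxE.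
have [<-{y}|xy] := eqVneq x y.
  rewrite (bigD1 x) //= eqxx mul1r mulr1 FE.
  rewrite -[LHS](subrK (\sum_(u | child x u) M x u * M u x / F u)).
  congr (_ + _); rewrite [LHS]big_mkcond [LHS](bigD1 x) //= cI add0r.
  apply: eq_bigr => u ux; rewrite eq_sym (negPf ux).
  case: ifP => _; last by rewrite !mul0r.
  by rewrite divfK // mulrA.
have [cxy|/negPf cxy] := boolP (child x y).
  rewrite (bigD1 y) //= eqxx (negPf xy) cxy mulr1 divfK // big1 ?addr0 // => j jy.
  rewrite (negPf jy); have [xj|_] := eqVneq x j.
    by rewrite -xj cA // mulr0.
  case: ifP => [xj|]; last by rewrite !mul0r.
  by case: ifP => [yj|]; [rewrite (cU _ _ _ xj yj) eqxx in xy | rewrite mulr0].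
have [cyx|/negPf cyx] := boolP (child y x).
  rewrite (bigD1 x) //= eqxx (negPf xy) cyx mul1r mulrC divfK // big1 ?addr0 // => j jx.
  rewrite eq_sym (negPf jx); case: ifP => [xj|]; last by rewrite !mul0r.
  have [jy|_] := eqVneq j y; first by rewrite jy cxy in xj.
  by case: ifP => [yj|]; [rewrite (cU _ _ _ xj yj) eqxx in xy | rewrite mulr0].
rewrite M0 ?cxy ?cyx // big1 // => j _.
have [xj|_] := eqVneq x j.
  by rewrite -xj (negPf xy) cyx mulr0.
case: ifP => [xj|]; last by rewrite !mul0r.
have [jy|_] := eqVneq j y; first by rewrite jy cxy in xj.
by case: ifP => [yj|]; [rewrite (cU _ _ _ xj yj) eqxx in xy | rewrite mulr0].
Qed.

(** * Local behaviour of rational functions *)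

Section LocalValues.
Variables (R : realFieldType) (K : fieldType) (phi : {rmorphism {poly R} -> K}).
Hypothesis phi_inj : injective phi.
Variable t : R.
Implicit Types (x y : K) (c : R).

(** Membership in the local ring at [t], with residue [c]; [K] stands for any field containing the
    polynomials, later their fraction field. *)
Definition regular_at x c :=
  exists p q : {poly R}, [/\ q.[t] != 0, x = (phi p) / (phi q) & p.[t] = c * q.[t]].

Lemma phi_eq0 p : (phi p == 0) = (p == 0).
Proof. by rewrite -(rmorph0 phi) (inj_eq phi_inj). Qed.

Lemma phi_horner_neq0 (q : {poly R}) : q.[t] != 0 -> (phi q) != 0 .
Proof. by move=> q0; rewrite phi_eq0; apply: contraNneq q0 => ->; rewrite horner0. Qed.

Lemma regular_poly (p : {poly R}) : regular_at (phi p) p.[t].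
Proof. by exists p, 1; rewrite rmorph1 divr1 !hornerE; split=> //; rewrite oner_neq0. Qed.

Lemma regularC c : regular_at (phi c%:P) c.
Proof. by have := regular_poly c%:P; rewrite hornerC. Qed.

Lemma regularD x y a b : regular_at x a -> regular_at y b -> regular_at (x + y) (a + b).
Proof.
move=> [p [q [q0 -> pE]]] [p' [q' [q0' -> pE']]]; exists (p * q' + p' * q), (q * q').
rewrite !hornerE mulf_neq0 // pE pE' !rmorphD !rmorphM /=; split=> //; last by ring.
by have ? := phi_horner_neq0 q0; have ? := phi_horner_neq0 q0'; field; apply/andP.
Qed.

Lemma regularM x y a b : regular_at x a -> regular_at y b -> regular_at (x * y) (a * b).
Proof.
move=> [p [q [q0 -> pE]]] [p' [q' [q0' -> pE']]]; exists (p * p'), (q * q').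
rewrite !hornerE mulf_neq0 // pE pE' !rmorphM /=; split=> //; last by ring.
by have ? := phi_horner_neq0 q0; have ? := phi_horner_neq0 q0'; field; apply/andP.
Qed.

Lemma regularN x a : regular_at x a -> regular_at (- x) (- a).
Proof.
move=> [p [q [q0 -> pE]]]; exists (- p), q.
by rewrite !hornerE pE rmorphN mulNr; split=> //; ring.
Qed.

Lemma regularV x a : a != 0 -> regular_at x a -> regular_at x^-1 a^-1.
Proof.
move=> a0 [p [q [q0 -> pE]]]; exists q, p; rewrite pE mulf_neq0 //; split=> //.
  by rewrite invfM invrK mulrC.
by rewrite mulKf.
Qed.

Lemma regular_prod (I : finType) (P : pred I) (y : I -> K) (c : I -> R) :
  (forall i, P i -> regular_at (y i) (c i)) ->
  regular_at (\prod_(i | P i) y i) (\prod_(i | P i) c i).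
Proof.
move=> yc; elim/big_ind2: _ => //; last by move=> *; exact: regularM.
by have := regularC 1; rewrite rmorph1.
Qed.

Lemma regular_neq0 x a : a != 0 -> regular_at x a -> x != 0.
Proof.
move=> a0 [p [q [q0 -> pE]]]; have p0 : p.[t] != 0 by rewrite pE mulf_neq0.
by rewrite mulf_neq0 // ?invr_eq0 phi_horner_neq0.
Qed.

Local Notation pi_ := (phi ('X - t%:P)).

Lemma XsubC_img_neq0 : pi_ != 0.
Proof. by rewrite phi_eq0 polyXsubC_eq0. Qed.
Local Hint Resolve XsubC_img_neq0 : core.

Lemma regular_pi_add y c d : regular_at y d -> regular_at (phi c%:P + pi_ * y) c.
Proof.
move=> rg; rewrite -[X in regular_at _ X]addr0.
apply: regularD (regularC c) _; rewrite -[X in regular_at _ X](mul0r d).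
by apply: regularM rg; have := regular_poly ('X - t%:P); rewrite hornerXsubC subrr.
Qed.

(* Local form at [t] of a Nevanlinna function: real with positive derivative, or
   a simple pole with negative residue. The value [None] stands for infinity. *)
Definition nevanlinna_at x (o : option R) :=
  exists y d, [/\ 0 < d, regular_at y d &
    if o is Some c then x = (phi c%:P) + pi_ * y else x * pi_ = - y].

Lemma nevanlinna_linear a : nevanlinna_at (phi ('X - a%:P)) (Some (t - a)).
Proof.
exists 1, 1; split=> //; first by have := regularC 1; rewrite rmorph1.
by rewrite mulr1 -rmorphD /= polyCB; congr (phi _); ring.
Qed.

(** All residues have the same sign, so poles cannot cancel; a finite summand leaves the residue of
    a pole unchanged. *)
Lemma nevanlinnaD x y o o' :
  nevanlinna_at x o -> nevanlinna_at y o' ->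
  nevanlinna_at (x + y)
    (if o is Some c then if o' is Some c' then Some (c + c') else None else None).
Proof.
move=> [y1 [d1 [d10 r1 E1]]] [y2 [d2 [d20 r2 E2]]].
case: o E1 => [c|] E1; case: o' E2 => [c'|] E2.
- exists (y1 + y2), (d1 + d2); split; [exact: addr_gt0|exact: regularD|].
  by rewrite E1 E2 polyCD rmorphD /=; ring.
- exists (y2 - (phi c%:P) * pi_ - pi_ * y1 * pi_), d2; split=> //.
    have rpi := regular_poly ('X - t%:P); rewrite hornerXsubC subrr in rpi.
    have := regularD (regularD r2 (regularN (regularM (regularC c) rpi)))
                     (regularN (regularM (regularM rpi r1) rpi)).
    by rewrite mulr0 mul0r mul0r oppr0 !addr0.
  by rewrite mulrDl E2 E1; ring.
- exists (y1 - (phi c'%:P) * pi_ - pi_ * y2 * pi_), d1; split=> //.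
    have rpi := regular_poly ('X - t%:P); rewrite hornerXsubC subrr in rpi.
    have := regularD (regularD r1 (regularN (regularM (regularC c') rpi)))
                     (regularN (regularM (regularM rpi r2) rpi)).
    by rewrite mulr0 mul0r mul0r oppr0 !addr0.
  by rewrite mulrDl E2 E1; ring.
- exists (y1 + y2), (d1 + d2); split; [exact: addr_gt0|exact: regularD|].
  by rewrite mulrDl E1 E2; ring.
Qed.

Lemma nevanlinnaZ s x o : 0 < s -> nevanlinna_at x o ->
  nevanlinna_at ((phi s%:P) * x) (omap ( *%R s) o).
Proof.
move=> s0 [y [d [d0 rg E]]]; exists ((phi s%:P) * y), (s * d).
split; [exact: mulr_gt0|exact: regularM (regularC s) rg|].
case: o E => [c|] /= E; first by rewrite E polyCM rmorphM /=; ring.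
by rewrite -mulrA E; ring.
Qed.

Lemma nevanlinna_neq0 x o : nevanlinna_at x o -> x != 0.
Proof.
move=> [y [d [d0 rg]]]; have y0 := regular_neq0 (lt0r_neq0 d0) rg.
case: o => [c|] E; last first.
  by apply: contra_eq_neq E => ->; rewrite mul0r eq_sym oppr_eq0.
have [c0|c0] := eqVneq c 0; first by rewrite E c0 rmorph0 add0r mulf_neq0.
by apply: (regular_neq0 (a := c)) => //; rewrite E; exact: regular_pi_add rg.
Qed.

(** The map [- x^-1] preserves the upper half-plane: it exchanges simple zeros and simple poles and
    keeps the signs of derivatives and residues. *)
Lemma nevanlinnaNV x o : nevanlinna_at x o ->
  nevanlinna_at (- x^-1)
    (if o is Some c then if c == 0 then None else Some (- c^-1) else Some 0).
Proof.
move=> nx; have x0 := nevanlinna_neq0 nx; case: nx => [y [d [d0 rg E]]].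
have y0 := regular_neq0 (lt0r_neq0 d0) rg.
case: o E => [c|] E; last first.
  exists y^-1, d^-1; split; [by rewrite invr_gt0|exact: regularV (lt0r_neq0 d0) rg|].
  have -> : y = - (x * pi_) by rewrite E opprK.
  by rewrite rmorph0 add0r; move: XsubC_img_neq0; generalize pi_ => w w0; field;
    rewrite oppr_eq0 mulf_neq0 ?x0.
have [c0|c0] := eqVneq c 0.
  rewrite c0 rmorph0 add0r in E.
  exists y^-1, d^-1; split; [by rewrite invr_gt0|exact: regularV (lt0r_neq0 d0) rg|].
  by rewrite E; move: XsubC_img_neq0; generalize pi_ => w w0; field; rewrite y0 w0.
have cF : (phi c%:P) != 0 by rewrite phi_eq0 polyC_eq0.
(* From [x = c + pi_ * y] follows [- x^-1 = - c^-1 + pi_ * y / (c * x)], and [c * x] takes the value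
   [c * c] at [t]. *)
exists (y / ((phi c%:P) * x)), (d / (c * c)); split.
- by rewrite divr_gt0 // -expr2 exprn_even_gt0.
- have rgx := rg; apply: regularM rg _; apply: regularV; first by rewrite mulf_neq0.
  by apply: regularM (regularC c) _; rewrite E; exact: regular_pi_add rgx.
have -> : phi (- c^-1)%:P = - (phi c%:P)^-1.
  apply: (mulIf cF); rewrite mulNr mulVf // -rmorphM -polyCM mulNr mulVf //.
  by rewrite polyCN rmorphN /= rmorph1.
have -> : pi_ * (y / ((phi c%:P) * x)) = (x - (phi c%:P)) / ((phi c%:P) * x).
  by rewrite mulrA -[pi_ * y](addKr (phi c%:P)) -E [- _ + x]addrC.
by field; rewrite x0 cF.
Qed.

Lemma nevanlinna_sum (I : finType) (P : pred I) (y : I -> K) (o : I -> option R) x c :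
  nevanlinna_at x (Some c) -> (forall i, P i -> nevanlinna_at (y i) (o i)) ->
  nevanlinna_at (x + \sum_(i | P i) y i)
    (if [exists i, P i && (o i == None)] then None
     else Some (c + \sum_(i | P i) odflt 0 (o i))).
Proof.
move=> nx ny.
have -> : [exists i, P i && (o i == None)] = has (fun i => P i && (o i == None)) (index_enum I).
  apply/existsP/hasP => [[i]|[i _]]; last by exists i.
  by exists i => //; rewrite mem_index_enum.
elim: (index_enum I) => [|i s IH]; first by rewrite !big_nil !addr0.
rewrite !big_cons /=; case: ifP => Pi //=.
have := nevanlinnaD (ny i Pi) IH.
rewrite addrCA; case oi: (o i) => [ci|] //=.
by case: ifP => // _; rewrite [in Some (c + _)]addrCA.
Qed.

(** Every factor is a unit at [t] times a power of [X - t] with exponent 1, 0 or -1, so the order of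
    the product counts zeros minus poles. *)
Lemma mup_nevanlinna_prod (I : finType) (F : I -> K) (o : I -> option R) (p : {poly R}) :
  (forall i, nevanlinna_at (F i) (o i)) -> (phi p) = \prod_i F i ->
  (mup t p + #|[pred i | o i == None]| = #|[pred i | o i == Some 0%R]|)%N.
Proof.
move=> nF pE.
(* The factor that clears a pole is kept on the left, so that only natural exponents of [X - t]
   occur. *)
have /fin_all_exists [y yP] i : exists y, exists2 d, d != 0 & regular_at y d /\
    F i * (if o i == None then pi_ else 1) = (if o i == Some 0 then pi_ else 1) * y.
  have [y [d [d0 rg E]]] := nF i; case: (o i) E => [c|] /= E; last first.
    exists (- y), (- d); first by rewrite oppr_eq0 lt0r_neq0.
    by split; [exact: regularN|rewrite E mul1r].
  have -> : (Some c == Some 0) = (c == 0) by [].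
  rewrite mulr1; have [c0|c0] := eqVneq c 0.
    by exists y, d; rewrite ?lt0r_neq0 //; split=> //; rewrite E c0 rmorph0 add0r.
  exists (F i), c => //; split; last by rewrite mul1r.
  by rewrite E; exact: regular_pi_add rg.
have /fin_all_exists2 [d d0 yd] i := yP i.
have : \prod_i F i * \prod_i (if o i == None then pi_ else 1) =
       \prod_i (if o i == Some 0 then pi_ else 1) * \prod_i y i.
  by rewrite -!big_split; apply: eq_bigr => i _ /=; have [_ ->] := yd i.
rewrite -!big_mkcond /= !prodr_const -pE.
have [a [b [b0 -> aE]]] : regular_at (\prod_i y i) (\prod_i d i).
  by apply: regular_prod => i _; have [] := yd i.
have a0 : a.[t] != 0 by rewrite aE mulf_neq0 //; apply/prodf_neq0 => i _.
have bF := phi_horner_neq0 b0.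
rewrite mulrA => /(congr1 ( *%R^~ (phi b))) /=; rewrite divfK //.
rewrite -!rmorphXn -!rmorphM /= => /phi_inj E.
have Pn0 : p != 0.
  rewrite -phi_eq0 pE; apply/prodf_neq0 => i _; exact: nevanlinna_neq0 (nF i).
have := congr1 (mup t) E; rewrite (mupMl _ (b0 : ~~ root b t)).
rewrite (mupMl _ (a0 : ~~ root a t)) mupM ?expf_neq0 ?polyXsubC_eq0 //.
by rewrite !mup_XsubCX eqxx => ->.
Qed.

End LocalValues.

(** * Layered structure of lush hedges *)

(** What the counting and the elimination need of a lush hedge. Vertices of height 0 have no
    children because [h] drops by one along each child edge. *)
Record lush_layered (n : nat) (child : rel 'I_n) (h : 'I_n -> nat) (r : 'I_n) : Prop := {
  layered_height : forall v u, child v u -> h v = (h u).+1;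
  layered_uniq : forall x y z, child x z -> child y z -> x = y;
  layered_parent : forall u, u != r -> exists v, child v u;
  layered_root : forall v, (h v <= h r)%N;
  layered_one : forall v, h v = 1%N -> (2 <= #|[set u | child v u]|)%N;
  layered_two : forall v, (2 <= h v)%N -> (3 <= #|[set u | child v u]|)%N }.

(** * Walks and graph distance *)

Section GraphDistance.
Variables (n : nat) (adj : rel 'I_n).
Hypothesis conn : forall x y, connect adj x y.

Lemma ballP x k y :
  reflect (exists p, [/\ path adj x p, last x p = y & (size p <= k)%N]) (y \in ball adj x k).
Proof.
apply: (iffP idP).
  elim: k y => [|k IH] y /=; first by rewrite inE => /eqP->; exists [::].
  rewrite !inE => /orP[/IH[p [? ? ?]]|]; first by exists p; split=> //; lia.
  case/existsP=> z /andP[/IH[p [pp lp sp]] zy].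
  by exists (rcons p y); rewrite rcons_path last_rcons size_rcons pp lp zy.
case=> p; elim/last_ind: p k y => [|p z IH] k y.
  case=> _ /= <- _; elim: k => [|k IH] /=; rewrite !inE ?eqxx //.
  by rewrite IH.
rewrite rcons_path last_rcons size_rcons => -[/andP[pp az] <-{y}].
case: k => // k sp /=; rewrite !inE; apply/orP; right; apply/existsP.
by exists (last x p); rewrite az andbT; apply: IH.
Qed.

Lemma dist_le x y k : y \in ball adj x k -> (dist adj x y <= k)%N.
Proof.
move=> yk; rewrite leqNgt; apply/negP => lt.
have kn : (k < n)%N by rewrite (leq_trans lt) // -[X in (_ <= X)%N](size_iota 0) find_size.
by have := before_find 0%N lt; rewrite nth_iota // yk.
Qed.

(** A walk without repeated vertices has fewer than [n] edges, so the search over [iota 0 n]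
    succeeds and [find] does not return its default. *)
Lemma dist_ball x y : (dist adj x y < n)%N /\ y \in ball adj x (dist adj x y).
Proof.
have hy : has (fun k => y \in ball adj x k) (iota 0 n).
  have /connectP[p pp ->] := conn x y; case/shortenP: pp => q pq uq _.
  apply/hasP; exists (size q); last by apply/ballP; exists q.
  rewrite mem_iota /= add0n; have := max_card (mem (x :: q)).
  by rewrite (card_uniqP uq) card_ord.
have lt : (dist adj x y < n)%N by rewrite /dist -[X in (_ < X)%N](size_iota 0) -has_find.
by split=> //; have := nth_find 0%N hy; rewrite nth_iota.
Qed.

Lemma dist_triangle x y z : (dist adj x z <= dist adj x y + dist adj y z)%N.
Proof.
have [_ /ballP[p [pp lp sp]]] := dist_ball x y.
have [_ /ballP[q [pq lq sq]]] := dist_ball y z.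
apply: dist_le; apply/ballP; exists (p ++ q).
by rewrite cat_path last_cat lp pp pq lq size_cat leq_add.
Qed.

Lemma dist_xx x : dist adj x x = 0%N.
Proof. by apply/eqP; rewrite -leqn0; apply: dist_le; rewrite inE. Qed.

Lemma dist_eq0 x y : dist adj x y = 0%N -> x = y.
Proof. by move=> d0; have [_] := dist_ball x y; rewrite d0 inE => /eqP. Qed.

Lemma dist_adj x y : adj x y -> x != y -> dist adj x y = 1%N.
Proof.
move=> xy ne; apply/eqP; rewrite eqn_leq; apply/andP; split.
  by apply: dist_le; apply/ballP; exists [:: y]; rewrite /= xy.
by rewrite lt0n; apply: contra ne => /eqP/dist_eq0->.
Qed.

Lemma dist_pred x y : x != y -> exists2 z, adj z y & dist adj x y = (dist adj x z).+1.
Proof.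
move=> ne; have [_] := dist_ball x y; case E: (dist adj x y) => [|k].
  by rewrite (dist_eq0 E) eqxx in ne.
rewrite /= !inE => /orP[/dist_le|/existsP[z /andP[/dist_le dz zy]]]; first by lia.
exists z => //; apply/eqP; rewrite eqSS eqn_leq dz andbT -ltnS -E.
apply: leq_trans (dist_triangle x z y) _; rewrite -addn1 leq_add2l.
by apply: dist_le; apply/ballP; exists [:: y]; rewrite /= zy.
Qed.

End GraphDistance.

Lemma bigminn_le (I : finType) (P : pred I) (F : I -> nat) m i :
  P i -> (\big[minn/m]_(j | P j) F j <= F i)%N.
Proof.
move=> Pi; have := mem_index_enum i; elim: (index_enum I) => // j s IH.
rewrite inE big_cons => /orP[/eqP<-|/IH]; first by rewrite Pi geq_minl.
by case: ifP => // _ le; apply: leq_trans (geq_minr _ _) le.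
Qed.

(** * Parents and children in a rooted tree *)

Section TreeParents.
Variables (n : nat) (adj : rel 'I_n) (r : 'I_n).
Hypothesis treeT : is_tree adj.
Local Notation child := (is_child adj r).
Local Notation depth := (dist adj r).

Lemma tree_conn x y : connect adj x y.
Proof. by case: treeT => _ _ ->. Qed.
Lemma tree_sym x y : adj x y = adj y x.
Proof. by case: treeT => _ [-> _]. Qed.
Lemma tree_irr x : adj x x = false.
Proof. by case: treeT => _ [_ /(_ x)/negPf]. Qed.

Lemma is_childE x y : child x y = adj x y && (depth y == (depth x).+1).
Proof.
rewrite /is_child /on_root_path; case xy: (adj x y) => //=.
have ne : x != y by apply: contraTneq xy => ->; rewrite tree_irr.
by rewrite (dist_adj tree_conn xy ne) addn1 eq_sym.
Qed.

(* The map from non-root vertices to their parent edge is injective; as a tree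
   has n - 1 edges, it is onto. *)
Lemma tree_parent : exists par : 'I_n -> 'I_n,
  (forall u, u != r -> child (par u) u) /\
  (forall x y, adj x y -> (x != r /\ par x = y) \/ (y != r /\ par y = x)).
Proof.
have /fin_all_exists [par parP] (u : 'I_n) : exists v, u != r -> child v u.
  have [->|ur] := eqVneq u r; first by exists r.
  have [v vu dv] := dist_pred tree_conn (x := r) (y := u) ltac:(by rewrite eq_sym).
  by exists v => _; rewrite is_childE vu dv eqxx.
exists par; split=> //.
have parD u : u != r -> depth u = (depth (par u)).+1.
  by move/parP; rewrite is_childE => /andP[_ /eqP].
have parA u : u != r -> adj (par u) u by move/parP/andP => [].
pose e (u : 'I_n) := if (u < par u)%N then (u, par u) else (par u, u).
pose E := [set p : 'I_n * 'I_n | adj p.1 p.2 && (p.1 < p.2)%N].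
have eE : e @: [set~ r] = E.
  apply/eqP; rewrite eqEcard; apply/andP; split.
    apply/subsetP => _ /imsetP[u ur ->]; rewrite !inE in ur *.
    rewrite /e; case: ltnP => /= lt; first by rewrite tree_sym parA.
    rewrite parA //= ltn_neqAle lt andbT.
    by apply: contraTneq (parA _ ur) => /val_inj->; rewrite tree_irr.
  rewrite card_in_imset.
    rewrite cardsC1 card_ord; case: treeT => _ _ _.
    by rewrite /n_edges -/E => ->.
  (* In the mixed cases [u] and [v] would be each other's parent, and each would be deeper than the
     other. *)
  move=> u v; rewrite !inE => ur vr; rewrite /e.
  have Du := parD u ur; have Dv := parD v vr.
  case: ifP => _; case: ifP => _ [] //.
  - by move=> uv pv; move: Du Dv; rewrite -uv pv; lia.
  - by move=> uv pv; move: Du Dv; rewrite -pv uv; lia.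
move=> x y; wlog lt : x y / (x < y)%N.
  move=> IH xy; case: (ltngtP x y) => [lt|lt|/val_inj eq]; first exact: IH.
    by have := IH y x lt; rewrite tree_sym => /(_ xy) []; [right|left].
  by rewrite eq tree_irr in xy.
move=> xy; have : (x, y) \in E by rewrite inE /= xy.
rewrite -eE => /imsetP[u]; rewrite !inE /e => ur.
by case: ifP => _ [-> ->]; [left|right].
Qed.

Lemma child_parent_uniq x y z : child x z -> child y z -> x = y.
Proof.
have [par [parP adjP]] := tree_parent.
suff H w : child w z -> w = par z by move=> /H-> /H->.
rewrite is_childE => /andP[wz /eqP dz]; case: (adjP _ _ wz) => -[nr e] //.
by move: (parP _ nr); rewrite e is_childE => /andP[_ /eqP]; rewrite dz; lia.
Qed.

Lemma tree_adjE x y : adj x y = child x y || child y x.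
Proof.
apply/idP/orP => [|[/andP[]//|/andP[]]]; last by rewrite tree_sym.
have [par [parP adjP]] := tree_parent.
by move/adjP => [[/parP c <-]|[/parP c <-]]; [right|left].
Qed.

(** The neighbours of a non-root vertex are its parent and its children, so degree one means
    childless. *)
Lemma tree_leafE v : v != r -> (n != 1)%N ->
  is_leaf adj r v = (children adj r v == set0).
Proof.
move=> vr n1; rewrite /is_leaf vr (negPf n1) orbF /=.
have [par [parP _]] := tree_parent.
rewrite /deg; have -> : [set u | adj v u] = par v |: children adj r v.
  apply/setP => u; rewrite !inE tree_adjE orbC; congr (_ || _).
  apply/idP/eqP => [uv|->]; last exact: parP.
  exact: child_parent_uniq uv (parP _ vr).
rewrite cardsU1 !inE; have -> : child v (par v) = false.
  have := parP _ vr; rewrite !is_childE => /andP[_ /eqP->]; apply/negP => /andP[_ /eqP]; lia.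
by rewrite add1n eqSS cards_eq0.
Qed.

End TreeParents.

(** * Heights in a lush hedge *)

Section LushHedge.
Variables (n : nat) (adj : rel 'I_n) (r : 'I_n).
Hypothesis lushT : is_lush adj r.
Hypothesis H2 : (2 <= height adj r)%N.
Local Notation child := (is_child adj r).
Local Notation depth := (dist adj r).

Let treeT : is_tree adj. Proof. by case: lushT => -[]. Qed.
Let conn := tree_conn treeT.

Let n_neq1 : n != 1%N.
Proof.
apply/eqP => n1; move: H2; rewrite /height /hgt.
have lr : is_leaf adj r r by apply/orP; right; exact/eqP.
by have := bigminn_le (fun v => dist adj r v) n lr; rewrite dist_xx; lia.
Qed.

Let childD v u : child v u -> depth u = (depth v).+1.
Proof. by rewrite is_childE // => /andP[_ /eqP]. Qed.

(** Going from child to child must stop, since depths stay below [n]. The last vertex is not the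
    root, which has children because its height is at least 2. *)
Lemma descendant_leaf u :
  exists v, [/\ v != r, is_leaf adj r v & (depth u + dist adj u v <= depth v)%N].
Proof.
have [m le] : exists m, (n - depth u <= m)%N by exists (n - depth u)%N.
elim: m u le => [|m IH] u le.
  by have [lt _] := dist_ball conn r u; lia.
have [/existsP[w uw]|/existsPn nc] := boolP [exists w, child u w].
  have := childD uw => dw; have [] := dist_ball conn r w => lt _.
  have [|v [vr lv vD]] := IH w; first by lia.
  exists v; split=> //; have := dist_triangle conn u w v.
  suff : (dist adj u w <= 1)%N by lia.
  by apply: dist_le; apply/ballP; exists [:: w]; case/andP: uw => /= ->.
have ch0 : children adj r u = set0 by apply/setP => w; rewrite !inE; apply/negbTE/nc.
have ur : u != r.
  apply/eqP => ur; have [_ /(_ r)[/(_ H2)]] := lushT.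
  by rewrite ur in ch0; rewrite ch0 cards0.
by exists u; rewrite dist_xx addn0 tree_leafE // ch0 eqxx.
Qed.

(** With all leaves at depth [d], the leaf found below [u] is at distance at most [d - depth u], and
    the triangle inequality forbids a nearer one. *)
Lemma hgt_depth : exists2 d, forall v, is_leaf adj r v -> depth v = d &
  forall u, (depth u <= d)%N /\ hgt adj r u = (d - depth u)%N.
Proof.
have [[_ [n1|[d dP]]] _] := lushT; first by move: n_neq1 => /eqP; case.
exists d => // u; have [v [vr lv vD]] := descendant_leaf u; rewrite (dP v lv) in vD.
split; first by lia.
apply/eqP; rewrite eqn_leq; apply/andP; split.
  by have := bigminn_le (fun v => dist adj u v) n lv; rewrite /hgt; lia.
rewrite /hgt; elim/big_ind: _ => [|a b|w lw].
(* The default [n] of the minimum does no harm: it exceeds every depth. *)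
- by have [] := dist_ball conn r v => + _; rewrite (dP v lv); lia.
- by rewrite leq_min => -> ->.
- by have := dist_triangle conn r u w; rewrite (dP w lw); lia.
Qed.

Lemma lush_hedge_layered : lush_layered child (hgt adj r) r.
Proof.
have [d leafD hD] := hgt_depth.
split.
- move=> v u vu; have [_ ->] := hD v; have [le ->] := hD u.
  by have := childD vu; lia.
- by move=> x y z; exact: child_parent_uniq.
- by move=> u ur; have [par [parP _]] := tree_parent r treeT; exists (par u); exact: parP.
- move=> v; have [_ ->] := hD v; have [_ ->] := hD r; rewrite dist_xx; lia.
- by move=> v hv; case: lushT => _ /(_ v)[_ /(_ hv)].
- by move=> v hv; case: lushT => _ /(_ v)[/(_ hv)].
Qed.

Lemma lush_hedge_leafE v : is_leaf adj r v = (hgt adj r v == 0%N).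
Proof.
have [d leafD hD] := hgt_depth; have [le hv] := hD v.
apply/idP/eqP => [/leafD|h0]; first by lia.
have vr : v != r.
  by apply/eqP => vr; move: H2; rewrite /height -(congr1 (hgt adj r) vr) h0.
rewrite tree_leafE //; apply/eqP/setP => u; rewrite !inE; apply/negbTE/negP => vu.
by have := layered_height lush_hedge_layered vu; rewrite h0.
Qed.

Lemma lush_hedge_adjE x y : adj x y = child x y || child y x.
Proof. exact: tree_adjE. Qed.

End LushHedge.

(** * Extremal zero patterns *)

(** The gain of a vertex of height [k] in the optimal pattern of period [p] starting at height [b]:
    zeros at [b], [b + p], and so on, each zero layer followed by a layer of poles. *)
Definition layer_weight (b p k : nat) : int :=
  ((b <= k) && (k == b %[mod p]))%N%:R - ((b < k) && (k == b.+1 %[mod p]))%N%:R.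

Lemma layer_weight_lt b p k : (k < b)%N -> layer_weight b p k = 0.
Proof. by rewrite /layer_weight => kb; rewrite leqNgt kb /= ltnNge ltnW. Qed.

Lemma layer_weight2 b k : (b <= k)%N ->
  layer_weight b 2 k = if odd (k - b) then -1 else 1.
Proof.
rewrite /layer_weight; move=> le; rewrite le /=.
case: (boolP (odd (k - b))) => od.
  have -> : (k == b %[mod 2]) = false by lia.
  by have -> : (b < k)%N && (k == b.+1 %[mod 2]) by lia.
have -> : (k == b %[mod 2]) by lia.
have -> : (k == b.+1 %[mod 2]) = false by lia.
by rewrite andbF.
Qed.

Lemma layer_weight3 b k : (b <= k)%N ->
  layer_weight b 3 k = if ((k - b) %% 3 == 0)%N then 1
                       else if ((k - b) %% 3 == 1)%N then -1 else 0.
Proof.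
rewrite /layer_weight; move=> le; rewrite le /=.
have -> : (k == b %[mod 3]) = ((k - b) %% 3 == 0)%N by lia.
have -> : (b < k)%N && (k == b.+1 %[mod 3]) = ((k - b) %% 3 == 1)%N by lia.
by case: eqP => [->|_] //; case: eqP.
Qed.

(** Summation by parts; the subtracted [c m] is the boundary term, present when the last selected
    index is [m - 1]. *)
Lemma sum_layer_weight (c : nat -> int) (b p m : nat) : (1 < p)%N ->
  \sum_(b <= k < m | k == b %[mod p]) (c k - c k.+1) =
  \sum_(0 <= k < m) layer_weight b p k * c k
    - (if (b < m)%N && (m == b.+1 %[mod p]) then c m else 0).
Proof.
move=> p1; elim: m => [|m IH]; first by rewrite !big_geq // subrr.
rewrite big_nat_recr //= addrAC; case: (leqP b m) => bm; last first.
  rewrite big_geq // layer_weight_lt // mul0r addr0 big1_seq ?subr0 => [|k].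
    by case: ifP => //; lia.
  by rewrite mem_index_iota => /andP[_ km]; rewrite layer_weight_lt ?mul0r //; lia.
rewrite big_mkcond big_nat_recr //= -big_mkcond IH /= /layer_weight ltnS bm /=.
have -> : (m.+1 == b.+1 %[mod p]) = (m == b %[mod p]).
  by rewrite -[m.+1]addn1 -[b.+1]addn1 eqn_modDr.
have : (m == b %[mod p]) -> (m == b.+1 %[mod p]) = false.
  move=> /eqP mb; apply/negbTE; rewrite mb -addn1 -[X in X == _ %[mod _]]addn0 eqn_modDl.
  by rewrite mod0n modn_small.
case: (m == b %[mod p]) => [/(_ isT)->|_]; last case: ifP => _;
  rewrite ?andbT ?andbF /=; move: (\sum_(0 <= k < m) _) => S; ring.
Qed.

Section Layered.
Variables (n : nat) (child : rel 'I_n) (h : 'I_n -> nat) (r : 'I_n).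
Hypothesis lay : lush_layered child h r.
Let hS := layered_height lay.

(** Recursion from the leaves upwards: after [k] iterations of [G] the values at heights below [k]
    no longer change. *)
Lemma layered_rec (T : Type) (t0 : T) (G : 'I_n -> ('I_n -> T) -> T) :
  (forall v f g, (forall u, child v u -> f u = g u) -> G v f = G v g) ->
  exists f, forall v, f v = G v f.
Proof.
move=> Gext; pose it k := iter k (fun f v => G v f) (fun=> t0).
have stab k v : (h v < k)%N -> it k v = it k.+1 v.
  elim: k v => // k IH v lt; rewrite /it /=; apply: Gext => u /hS hv.
  by apply: IH; lia.
exists (it (h r).+1) => v; rewrite stab //=; have := layered_root lay v; lia.
Qed.

Lemma layered_ind (P : 'I_n -> Prop) :
  (forall v, (forall u, child v u -> P u) -> P v) -> forall v, P v.
Proof.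
move=> IH v; have [m] := ubnP (h v); elim: m v => // m IHm v lt.
by apply: IH => u /hS hv; apply: IHm; lia.
Qed.

Lemma layered_down (P : 'I_n -> Prop) :
  P r -> (forall v u, child v u -> P v -> P u) -> forall v, P v.
Proof.
move=> Pr step v; have [m] := ubnP (h r - h v); elim: m v => // m IH v lt.
have [->//|/(layered_parent lay) [w wv]] := eqVneq v r.
by apply: step (wv) (IH _ _); have := hS wv; have := layered_root lay w; lia.
Qed.

Lemma layered_child v : (0 < h v)%N -> exists u, child v u.
Proof.
move=> hv; have : (0 < #|[set u | child v u]|)%N.
  case: (ltnP 1 (h v)) => h2; first by have := layered_two lay h2; lia.
  by have := @layered_one _ _ _ _ lay v; lia.
by case/card_gt0P => u; rewrite inE; exists u.
Qed.

Lemma layered_nonempty i : (i <= h r)%N -> exists v, h v = i.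
Proof.
move=> le; have : forall m, (m <= h r)%N -> exists v, h v = (h r - m)%N.
  elim=> [|m IH] lm; first by exists r; lia.
  have [v hv] := IH (ltnW lm); have [|u /hS vu] := @layered_child v; first by lia.
  by exists u; lia.
by move=> /(_ (h r - i)%N (leq_subr _ _)) [v hv]; exists v; lia.
Qed.

Local Notation layer i := [set v : 'I_n | h v == i].

(** Choosing a child for each vertex is injective, because parents are unique. Hence the truncated
    subtraction in [ell] is exact. *)
Lemma layer_card_le i : (#|layer i.+1| <= #|layer i|)%N.
Proof.
have /fin_all_exists [f fP] v : exists u, (0 < h v)%N -> child v u.
  by case: (ltnP 0 (h v)) => hv; [have [u] := layered_child hv; exists u|exists v].
have inj : {in layer i.+1 &, injective f}.
  move=> x y; rewrite !inE => /eqP hx /eqP hy fxy.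
  apply: (layered_uniq lay (fP x _)); rewrite ?hx //; rewrite fxy; apply: fP; lia.
rewrite -(card_in_imset inj); apply/subset_leq_card/subsetP => _ /imsetP[v + ->].
by rewrite !inE => /eqP hv; have := hS (fP v ltac:(lia)); rewrite hv => -[->].
Qed.

Lemma layer_empty i : (h r < i)%N -> #|layer i| = 0%N.
Proof.
move=> lt; apply/eqP; rewrite cards_eq0; apply/eqP/setP => v; rewrite !inE.
by apply/negbTE; have := layered_root lay v; lia.
Qed.

Lemma big_by_layer (T : Type) (idx : T) (op : Monoid.com_law idx) (w : nat -> T) m :
  (h r < m)%N ->
  \big[op/idx]_v w (h v) = \big[op/idx]_(0 <= k < m) \big[op/idx]_(v in layer k) w k.
Proof.
move=> lt; rewrite big_mkord.
rewrite (partition_big (fun v => inord (h v) : 'I_m.-1.+1) predT) //=.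
have m0 : m = m.-1.+1 by lia.
rewrite [in RHS]m0; apply: eq_bigr => k _.
apply: eq_big => v; rewrite ?inE -?val_eqE /= ?inordK //.
- by have := layered_root lay v; lia.
- by move/eqP->.
by have := layered_root lay v; lia.
Qed.

Lemma sum_child (V : nmodType) (g : 'I_n -> V) :
  \sum_v \sum_(u | child v u) g u = \sum_(u | u != r) g u.
Proof.
rewrite (exchange_big_dep predT) //= [RHS]big_mkcond; apply: eq_bigr => u _.
have [->|ur] := eqVneq u r.
  by apply: big1 => v vr; have := layered_root lay v; have := hS vr; lia.
have [v vu] := layered_parent lay ur.
rewrite (bigD1 v) //= big1 ?addr0 // => w /andP[wu]; case/eqP.
exact: (layered_uniq lay wu vu).
Qed.

(* Summing the local inequalities telescopes, leaving only the root's penalty. *)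
Lemma penalty_tight (gain pat pen : 'I_n -> int) :
  (forall v, gain v + pen v <= pat v + \sum_(u | child v u) pen u) ->
  0 <= pen r -> \sum_v pat v <= \sum_v gain v ->
  [/\ \sum_v gain v = \sum_v pat v, pen r = 0 &
      forall v, gain v + pen v = pat v + \sum_(u | child v u) pen u].
Proof.
move=> loc pr le.
have E : \sum_v (pat v + \sum_(u | child v u) pen u - (gain v + pen v)) =
         \sum_v pat v - \sum_v gain v - pen r.
  rewrite sumrB !big_split /= sum_child [\sum_i pen i](bigD1 r) //=; ring.
have ge0 v : 0 <= pat v + \sum_(u | child v u) pen u - (gain v + pen v).
  by rewrite subr_ge0.
have ge : 0 <= \sum_v pat v - \sum_v gain v - pen r by rewrite -E; apply: sumr_ge0.
have [e1 e2] : \sum_v gain v = \sum_v pat v /\ pen r = 0 by lia.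
split=> // v; apply/eqP; rewrite eq_sym -subr_eq0.
move/eqP: E; rewrite e1 e2 subrr subr0 psumr_eq0 // => /allP/(_ v).
by rewrite mem_index_enum => /(_ isT).
Qed.

(** [z] marks the zeros and [i] the resulting poles. *)
Variable z : pred 'I_n.
Let i v := [exists u, child v u && z u].
Hypothesis zi : forall v, z v -> ~~ i v.

Lemma childless_pole v : (forall u, child v u -> ~~ z u) -> i v = false.
Proof. by move=> vz; apply/negbTE/existsPn => u; apply/negP => /andP[/vz/negPf->]. Qed.

Lemma sum_gain : \sum_v ((z v)%:R - (i v)%:R) = #|z|%:Z - #|i|%:Z.
Proof.
rewrite sumrB -!natr_sum.
have C (P : pred 'I_n) : (\sum_(v : 'I_n) P v)%N = #|P|.
  by rewrite -sum1_card [RHS]big_mkcond; apply: eq_bigr => v _; rewrite unfold_in; case: (P v).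
by rewrite !C !natz.
Qed.

Lemma sum_pen_ge (pen : 'I_n -> int) v :
  (forall u, child v u -> 1 <= pen u) ->
  #|[set u | child v u]|%:Z <= \sum_(u | child v u) pen u.
Proof.
move=> ge; rewrite -sum1_card -natz natr_sum.
by under eq_bigl do rewrite inE; exact: ler_sum.
Qed.

Lemma sum_pen_child (pen : 'I_n -> int) v u :
  (forall u, 0 <= pen u) -> child v u -> pen u <= \sum_(u | child v u) pen u.
Proof. by move=> ge0 vu; rewrite (bigD1 u) //= lerDl sumr_ge0. Qed.

(** A vertex at odd offset that is not a pole has only nonzero children, each with penalty 1. Three
    such children pay for its gain and penalty. At height 1 only two are guaranteed, so a zero there
    carries no penalty. Tightness then spreads the pattern from the root downwards. *)
Lemma zero_pattern2 b : (b <= 1)%N -> (2 <= h r)%N ->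
  (forall v, (h v < b)%N -> ~~ z v) ->
  \sum_v layer_weight b 2 (h v) <= #|z|%:Z - #|i|%:Z ->
  #|z|%:Z - #|i|%:Z = \sum_v layer_weight b 2 (h v) /\
  forall v, (b <= h v)%N -> z v = ~~ odd (h v - b) /\ i v = odd (h v - b).
Proof.
move=> b1 H2 zb; rewrite -sum_gain => le.
pose pen v : int := if (h v < b)%N then 0 else if ~~ odd (h v - b) then (~~ z v)%:R
  else if i v then 0 else if z v && (h v == 1%N) then 0 else 1.
have pen0 v : 0 <= pen v by rewrite /pen; do 4![case: ifP => // _].
have ib v : (h v <= b)%N -> i v = false.
  by move=> hv; apply: childless_pole => u /hS hu; apply: zb; lia.
case: (@penalty_tight _ (fun v => layer_weight b 2 (h v)) pen _ _ le) => // [v|-> penr tight].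
  have [S SE] : {S | S = \sum_(u | child v u) pen u} by eexists.
  have S0 : 0 <= S by rewrite SE sumr_ge0.
  rewrite -SE.
  have [lt|ge] := ltnP (h v) b.
    by rewrite layer_weight_lt // {1}/pen lt (negPf (zb _ lt)) ib ?(ltnW lt) //; lia.
  rewrite layer_weight2 // {1}/pen ltnNge ge /=.
  case: (boolP (odd _)) => /= od; last by case: (z v); case: (i v) => /=; lia.
  case: (boolP (i v)) => iv.
    have -> : z v = false by apply/negbTE; apply: contraL iv; exact: zi.
    by lia.
  have : #|[set u | child v u]|%:Z <= S.
    rewrite SE; apply: sum_pen_ge => u vu; have hu := hS vu; rewrite /pen.
    have -> : (h u < b)%N = false by lia.
    have -> /= : ~~ odd (h u - b) by lia.
    suff -> : z u = false by [].
    by apply/negbTE/negP => zu; case/existsP: iv; exists u; rewrite vu.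
  case: (eqVneq (h v) 1%N) => h1.
    by have := layered_one lay h1; case: (z v) => /=; lia.
  have /(layered_two lay) : (2 <= h v)%N by lia.
  by case: (z v) => /=; lia.
split=> //; apply: layered_down => [br|v u vu IH bu].
  move: penr; rewrite /pen ltnNge br /=.
  case: (boolP (odd _)) => /= od; last first.
    by case: (boolP (z r)) => // /zi /negPf->.
  case: (boolP (i r)) => iv; last by case: ifP => // /andP[_ /eqP]; lia.
  by move=> _; split=> //; apply/negbTE; apply: contraL iv; exact: zi.
have hu := hS vu; have [|zv iv] := IH; first by lia.
(* Since [v] follows the pattern and has penalty 0, tightness makes the penalties of its children
   sum to 0. *)
have : pen u = 0.
  apply/le_anti; rewrite pen0 andbT; apply: le_trans (sum_pen_child pen0 vu) _.
  have := tight v; move: (\sum_(u | child v u) pen u) => S; rewrite layer_weight2; last by lia.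
  rewrite {1}/pen zv iv; have -> : (h v < b)%N = false by lia.
  by case: (odd _) => /=; lia.
rewrite /pen ltnNge bu /=.
case: (boolP (odd (h u - b))) => /= od; last first.
  by case: (boolP (z u)) => // /zi /negPf->.
case: (boolP (i u)) => iu; first by split=> //; apply/negbTE; apply: contraL iu; exact: zi.
case: ifP => // /andP[zu /eqP h1] _.
(* The exempted zero of height 1 would make its parent a pole, but the parent has even offset. *)
have : i v by apply/existsP; exists u; rewrite vu.
by rewrite iv; lia.
Qed.

(** At offset 1 modulo 3 a zero costs 1 and a vertex that is neither zero nor pole costs 2; either
    is paid by at least three nonzero children, since [1 <= b] puts this offset at height 2 or
    more. *)
Lemma zero_pattern3 b : (1 <= b <= h r)%N ->
  (forall v, (h v < b)%N -> ~~ z v) ->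
  (forall v, (b < h v)%N -> z v -> exists u, [/\ child v u, ~~ z u & ~~ i u]) ->
  \sum_v layer_weight b 3 (h v) <= #|z|%:Z - #|i|%:Z ->
  forall v, (b <= h v)%N -> z v = ((h v - b) %% 3 == 0)%N /\ i v = ((h v - b) %% 3 == 1)%N.
Proof.
move=> /andP[b1 bH] zb zN; rewrite -sum_gain => le.
pose pen v : int := if (h v < b)%N then 0 else
  if ((h v - b) %% 3 == 0)%N then (~~ z v)%:R
  else if ((h v - b) %% 3 == 1)%N then (if i v then 0 else if z v then 1 else 2)
  else (z v || i v)%:R.
have pen0 v : 0 <= pen v by rewrite /pen; do 5![case: ifP => // _].
have ib v : (h v <= b)%N -> i v = false.
  by move=> hv; apply: childless_pole => u /hS hu; apply: zb; lia.
case: (@penalty_tight _ (fun v => layer_weight b 3 (h v)) pen _ _ le) => // [v|_ penr tight].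
  have [S SE] : {S | S = \sum_(u | child v u) pen u} by eexists.
  have S0 : 0 <= S by rewrite SE sumr_ge0.
  rewrite -SE.
  have [lt|ge] := ltnP (h v) b.
    by rewrite layer_weight_lt // {1}/pen lt (negPf (zb _ lt)) ib ?(ltnW lt) //; lia.
  rewrite layer_weight3 // {1}/pen ltnNge ge /=.
  case: (eqVneq ((h v - b) %% 3)%N 0%N) => m0; first by case: (z v); case: (i v) => /=; lia.
  case: (eqVneq ((h v - b) %% 3)%N 1%N) => m1.
    case: (boolP (i v)) => iv.
      have -> : z v = false by apply/negbTE; apply: contraL iv; exact: zi.
      by lia.
    have : #|[set u | child v u]|%:Z <= S.
      rewrite SE; apply: sum_pen_ge => u vu; have hu := hS vu; rewrite /pen.
      have -> : (h u < b)%N = false by lia.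
      have -> /= : ((h u - b) %% 3 == 0)%N by lia.
      suff -> : z u = false by [].
      by apply/negbTE/negP => zu; case/existsP: iv; exists u; rewrite vu.
    have /(layered_two lay) : (2 <= h v)%N by lia.
    by case: (z v) => /=; lia.
  case: (boolP (z v)) => zv; last by case: (i v) => /=; lia.
  (* A zero at offset 2 has gain 1 and penalty 1. Its child that is neither zero nor pole has
     penalty 2 and pays for both. *)
  rewrite (negPf (zi zv)) /=; have [|u [vu zu iu]] := zN v _ zv; first by lia.
  have := sum_pen_child pen0 vu; have hu := hS vu; rewrite -SE /pen.
  have -> : (h u < b)%N = false by lia.
  have -> : ((h u - b) %% 3 == 0)%N = false by lia.
  have -> : ((h u - b) %% 3 == 1)%N by lia.
  by rewrite (negPf zu) (negPf iu); lia.
have P0 v : (b <= h v)%N -> pen v = 0 ->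
    z v = ((h v - b) %% 3 == 0)%N /\ i v = ((h v - b) %% 3 == 1)%N.
  move=> bv; rewrite /pen ltnNge bv /=.
  case: (eqVneq ((h v - b) %% 3)%N 0%N) => [->|m0].
    by case: (boolP (z v)) => // /zi /negPf->.
  case: (eqVneq ((h v - b) %% 3)%N 1%N) => m1.
    case: (boolP (i v)) => iv; last by case: ifP.
    by split=> //; apply/negbTE; apply: contraL iv; exact: zi.
  by case: (z v); case: (i v).
apply: layered_down => [br|v u vu IH bu]; first exact: P0.
have hu := hS vu; have [|zv iv] := IH; first by lia.
apply: P0 => //; apply/le_anti; rewrite pen0 andbT; apply: le_trans (sum_pen_child pen0 vu) _.
have := tight v; move: (\sum_(u | child v u) pen u) => S; rewrite layer_weight3; last by lia.
rewrite {1}/pen zv iv; have -> : (h v < b)%N = false by lia.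
case: (eqVneq ((h v - b) %% 3)%N 0%N) => [->|m0] /=; first by lia.
by case: (eqVneq ((h v - b) %% 3)%N 1%N) => [m1|m1] /=; lia.
Qed.

(** If height 2 consists of zeros, height 3 consists of poles. A pole above that has a zero child of
    height at least 4, which pays for it, so the higher layers contribute no loss. *)
Lemma zero_layer2 :
  (forall v, (h v <= 1)%N -> ~~ z v) -> (forall v, h v = 2%N -> z v) ->
  #|layer 2|%:Z - #|layer 3|%:Z <= #|z|%:Z - #|i|%:Z.
Proof.
move=> z1 z2; rewrite -sum_gain.
have i3 v : h v = 3%N -> i v.
  move=> hv; have [|u vu] := @layered_child v; first by lia.
  by apply/existsP; exists u; rewrite vu z2 //; have := hS vu; lia.
pose y v : int := ((4 <= h v)%N && z v)%:R.
have -> : #|layer 2|%:Z - #|layer 3|%:Z = \sum_v ((h v == 2%N)%:R - (h v == 3%N)%:R).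
  rewrite sumrB -!natr_sum !natz -!sum1_card.
  by congr (Posz _ - Posz _); rewrite big_mkcond; apply: eq_bigr => v _; rewrite inE; case: eqP.
have loc v : ((h v == 2%N)%:R - (h v == 3%N)%:R) + y v <=
    (z v)%:R - (i v)%:R + \sum_(u | child v u) y u :> int.
  have y0 u : 0 <= y u by rewrite /y; case: (_ && _).
  have [S SE] : {S | S = \sum_(u | child v u) y u} by eexists.
  have S0 : 0 <= S by rewrite SE sumr_ge0.
  rewrite -SE.
  rewrite {1}/y; case: (ltnP 3 (h v)) => h4 /=; last first.
    case: (ltngtP (h v) 2) => h2.
    - have -> : (h v == 3%N) = false by lia.
      rewrite (negPf (z1 v _)) ?childless_pole //; first by lia.
      by move=> u /hS hu; apply: z1; lia.
    - have hv : h v = 3%N by lia.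
      by rewrite hv i3 //; case: (z v); lia.
    have zv := z2 v h2; rewrite h2 zv (negPf (zi zv)) /=; lia.
  have -> : (h v == 2%N) = false by lia.
  have -> : (h v == 3%N) = false by lia.
  case: (boolP (i v)) => [/existsP[u /andP[vu zu]]|_]; last by lia.
  have := sum_pen_child y0 vu; rewrite -SE /y zu.
  have hu := hS vu; case: (ltnP 3 (h u)) => h4' /=; first by lia.
  have h3 : h u = 3%N by lia.
  by have := zi zu; rewrite i3.
have : \sum_v ((h v == 2%N)%:R - (h v == 3%N)%:R + y v) <=
    \sum_v ((z v)%:R - (i v)%:R + \sum_(u | child v u) y u) by apply: ler_sum.
rewrite big_split [X in _ <= X]big_split /= sum_child [\sum_v y v](bigD1 r) //=.
rewrite addrA lerD2r; apply: le_trans; rewrite lerDl /y; by case: (_ && _).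
Qed.

End Layered.

(** * Multiplicities from leaf-to-root values *)

Section TreeMatrix.
Variables (R : realFieldType) (n : nat) (child : rel 'I_n) (h : 'I_n -> nat) (r : 'I_n).
Hypothesis lay : lush_layered child h r.
Variable A : 'M[R]_n.
Hypothesis A0 : forall x y, x != y -> ~~ child x y -> ~~ child y x -> A x y = 0.
Hypothesis Apos : forall v u, child v u -> 0 < A v u * A u v.

(** An infinite child contributes nothing to the value of its parent. *)
Definition inv_val (o : option R) := if o is Some c then c^-1 else 0.

Definition leaf_to_root (t : R) (o : 'I_n -> option R) := forall v,
  o v = if [exists u, child v u && (o u == Some 0)] then None
        else Some (t - A v v - \sum_(u | child v u) A v u * A u v * inv_val (o u)).

Lemma leaf_to_root_exists t : exists o, leaf_to_root t o.
Proof.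
apply: (layered_rec lay (Some 0)) => v f g fg.
have -> : [exists u, child v u && (f u == Some 0)] = [exists u, child v u && (g u == Some 0)].
  by apply: eq_existsb => u; case: (boolP (child v u)) => //= vu; rewrite fg.
by case: ifP => // _; congr (Some (_ - _)); apply: eq_bigr => u vu; rewrite fg.
Qed.

Section Fractions.
Variables (K : fieldType) (phi : {rmorphism {poly R} -> K}).
Hypothesis phi_inj : injective phi.

(** The pivots of the elimination over rational functions; [leaf_to_root] describes their behaviour
    at one point. *)
Definition schur_recurrence (F : 'I_n -> K) := forall v,
  F v = phi ('X - (A v v)%:P) - \sum_(u | child v u) phi (A v u * A u v)%:P / F u.

Lemma schur_exists : exists F, schur_recurrence F.
Proof.
apply: (layered_rec lay 0) => v f g fg.
by congr (_ - _); apply: eq_bigr => u vu; rewrite fg.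
Qed.

(** A pivot is a monic linear polynomial plus positive multiples of the [- (F u)^-1], and being
    locally Nevanlinna is preserved by these operations. *)
Lemma schur_nevanlinna F t o : schur_recurrence F -> leaf_to_root t o ->
  forall v, nevanlinna_at phi t (F v) (o v).
Proof.
move=> FE oE; apply: (layered_ind lay) => v IH.
pose w u := omap ( *%R (A v u * A u v))
  (if o u is Some c then if c == 0 then None else Some (- c^-1) else Some 0).
have := nevanlinna_sum phi_inj (P := child v) (o := w) (nevanlinna_linear phi t (A v v))
  (fun u vu => nevanlinnaZ phi_inj (Apos vu) (nevanlinnaNV phi_inj (IH u vu))).
have -> : phi ('X - (A v v)%:P) +
    \sum_(u | child v u) phi (A v u * A u v)%:P * (- (F u)^-1) = F v.
  by rewrite [RHS]FE -sumrN; congr (_ + _); apply: eq_bigr => u _; rewrite mulrN.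
suff -> : o v = if [exists u, child v u && (w u == None)] then None
   else Some (t - A v v + \sum_(u | child v u) odflt 0 (w u)) by [].
rewrite oE; have -> : [exists u, child v u && (w u == None)] =
    [exists u, child v u && (o u == Some 0)].
  apply: eq_existsb => u; congr (_ && _); rewrite /w; case: (o u) => [c|] //=.
  by have -> : (Some c == Some 0) = (c == 0) by []; case: (c == 0).
case: ifP => // _; rewrite -sumrN; congr (Some (_ + _)); apply: eq_bigr => u _.
rewrite /w /inv_val; case: (o u) => [c|] /=; last by rewrite mulr0 oppr0.
by have [->|_] /= := eqVneq c 0; rewrite ?invr0 ?mulr0 ?oppr0 ?mulrN.
Qed.

Lemma schur_neq0 F : schur_recurrence F -> forall v, F v != 0.
Proof.
(* Any point serves here: a locally Nevanlinna function is not identically zero. *)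
move=> FE v; have [o oE] := leaf_to_root_exists 0.
exact: (nevanlinna_neq0 phi_inj (schur_nevanlinna FE oE v)).
Qed.

Lemma char_poly_schur F : schur_recurrence F -> phi (char_poly A) = \prod_v F v.
Proof.
move=> FE; rewrite /char_poly -det_map_mx.
have AE x y : (map_mx phi (char_poly_mx A)) x y = phi ('X *+ (x == y) - (A x y)%:P).
  by rewrite !mxE.
(* The rank has to grow from parent to child, hence the depth [h r - h v]. *)
apply: (@det_forest _ _ child (fun v => h r - h v)%N).
- by move=> x y xy; have := layered_height lay xy; have := layered_root lay x; lia.
- exact: layered_uniq lay.
- move=> x y xy c1 c2; rewrite AE A0 // (negPf xy) mulr0n subrr; exact: rmorph0.
- exact: schur_neq0.
move=> x; rewrite FE AE eqxx mulr1n; congr (_ - _); apply: eq_bigr => u xu.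
have ux : (x == u) = false.
  by apply/negbTE/eqP => E; have := layered_height lay xu; rewrite E; lia.
rewrite !AE ux eq_sym ux !mulr0n !sub0r -rmorphM /= polyCM.
by congr (phi _ / _); ring.
Qed.

End Fractions.

Lemma mup_leaf_to_root t o : leaf_to_root t o ->
  (mup t (char_poly A) + #|[pred v | o v == None]| = #|[pred v | o v == Some 0%R]|)%N.
Proof.
move=> oE; pose phi : {rmorphism {poly R} -> {fraction {poly R}}} := @tofrac _.
have phi_inj : injective phi by move=> p q /eqP; rewrite tofrac_eq => /eqP.
have [F FE] := schur_exists phi.
apply: (mup_nevanlinna_prod phi_inj (schur_nevanlinna phi_inj FE oE)).
exact: char_poly_schur.
Qed.

(** * Values at a fixed point and the patterns they follow *)

Section Values.
Variables (t : R) (o : 'I_n -> option R).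
Hypothesis oE : leaf_to_root t o.
Let z : pred 'I_n := [pred v | o v == Some 0].

Lemma pole_iff v : (o v == None) = [exists u, child v u && z u].
Proof. by rewrite oE; case: ifP. Qed.

Lemma zero_not_pole v : z v -> ~~ [exists u, child v u && z u].
Proof. by rewrite -pole_iff => /eqP ->. Qed.

Lemma value_over_poles v :
  (forall u, child v u -> o u = None) -> o v = Some (t - A v v).
Proof.
move=> vN; rewrite oE ifF; last by apply/existsPn => u; apply/negP => /andP[/vN->].
by rewrite big1 ?subr0 // => u /vN ->; rewrite mulr0.
Qed.

Lemma value_over_const v c : c != 0 -> (forall u, child v u -> o u = Some c) ->
  o v = Some (t - A v v - (\sum_(u | child v u) A v u * A u v) / c).
Proof.
move=> c0 vc; rewrite oE ifF; last first.
  by apply/existsPn => u; apply/negP => /andP[/vc-> /eqP[/eqP]]; rewrite (negPf c0).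
by rewrite mulr_suml; congr (Some (_ - _)); apply: eq_bigr => u /vc ->.
Qed.

Let mult_zero_pole :
  #|z|%:Z - #|(fun v => [exists u, child v u && z u])|%:Z = (mup t (char_poly A))%:Z.
Proof.
have := mup_leaf_to_root oE; rewrite (eq_card (A := [pred v | o v == None])
  (B := fun v => [exists u, child v u && z u])); last first.
  by move=> v; rewrite inE pole_iff.
by move=> E; rewrite -[#|z|]E PoszD addrK.
Qed.

Lemma values2 b : (b <= 1)%N -> (2 <= h r)%N ->
  (forall v, (h v < b)%N -> o v != Some 0) ->
  \sum_v layer_weight b 2 (h v) <= (mup t (char_poly A))%:Z ->
  (mup t (char_poly A))%:Z = \sum_v layer_weight b 2 (h v) /\
  forall v, (b <= h v)%N -> o v = if odd (h v - b) then None else Some 0.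
Proof.
move=> b1 H2 ob; rewrite -mult_zero_pole => le.
have [-> pat] := zero_pattern2 lay zero_not_pole b1 H2 ob le.
split=> // v /pat [zv iv]; rewrite -pole_iff in iv.
by case: (odd _) zv iv => [_ /eqP|/eqP].
Qed.

(** A vertex whose children are all infinite has value [t - A v v], nonzero above height [b]. So a
    zero above [b] has a child that is neither zero nor pole, as [zero_pattern3] requires. *)
Lemma values3 b : (1 <= b <= h r)%N ->
  (forall v, (h v < b)%N -> o v != Some 0) ->
  (forall v, (b < h v)%N -> A v v != t) ->
  \sum_v layer_weight b 3 (h v) <= (mup t (char_poly A))%:Z ->
  forall v, (b <= h v)%N -> o v = if ((h v - b) %% 3 == 0)%N then Some 0
    else if ((h v - b) %% 3 == 1)%N then None else Some (t - A v v).
Proof.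
move=> bH ob At; rewrite -mult_zero_pole => le.
have zN v : (b < h v)%N -> z v ->
    exists u, [/\ child v u, ~~ z u & ~~ [exists w, child u w && z w]].
  move=> bv zv.
  suff /existsP[u /and3P H] : [exists u, [&& child v u, ~~ z u
      & ~~ [exists w, child u w && z w]]] by exists u.
  apply: contraT => /existsPn nu.
  have := zero_not_pole zv => /existsPn nz.
  have : o v = Some (t - A v v).
    apply: value_over_poles => u vu; apply/eqP; rewrite pole_iff.
    by have := nu u; have := nz u; rewrite vu /= => -> /=; rewrite negbK.
  by move/eqP: zv => -> [/eqP]; rewrite eq_sym subr_eq0 eq_sym (negPf (At v bv)).
have pat := zero_pattern3 lay zero_not_pole bH ob zN le.
move=> v bv; have [zv iv] := pat v bv; rewrite -pole_iff in iv.
have [m0|m0] := eqVneq ((h v - b) %% 3)%N 0%N.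
  by apply/eqP; move: zv; rewrite m0 eqxx.
have [m1|m1] := eqVneq ((h v - b) %% 3)%N 1%N.
  by apply/eqP; rewrite iv m1.
apply: value_over_poles => u vu; apply/eqP; have hv := layered_height lay vu.
by have [|_] := pat u; [lia|rewrite -pole_iff => ->; lia].
Qed.

(* The children of such a vertex have only poles below them, so their value is t - a. *)
Lemma weight_above_base b a1 a2 : (1 <= b <= h r)%N ->
  (forall v, (h v < b)%N -> o v != Some 0) ->
  (forall v, (b < h v)%N -> A v v = if odd (h v) then a2 else a1) ->
  a1 != t -> a2 != t ->
  \sum_v layer_weight b 3 (h v) <= (mup t (char_poly A))%:Z ->
  forall v, (b.+3 <= h v)%N -> ((h v - b) %% 3 = 0)%N ->
  \sum_(u | child v u) A v u * A u v = (t - a1) * (t - a2).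
Proof.
move=> bH ob Av a1t a2t le v bv m0.
have At w : (b < h w)%N -> A w w != t by move/Av->; case: ifP.
have val := values3 bH ob At le.
pose c := if odd (h v) then t - a1 else t - a2.
have c0 : c != 0 by rewrite /c; case: ifP; rewrite subr_eq0 eq_sym.
have uc u : child v u -> o u = Some c.
  move=> /(layered_height lay) hv; rewrite val; last by lia.
  have -> : ((h u - b) %% 3 == 0)%N = false by lia.
  have -> : ((h u - b) %% 3 == 1)%N = false by lia.
  by rewrite Av ?/c ?hv /=; [case: (odd (h u))|lia].
have := value_over_const c0 uc; rewrite val; last by lia.
rewrite m0 /= => -[/esym/eqP]; rewrite subr_eq0 => /eqP E.
rewrite -[LHS](divfK c0) -E Av /c; last by lia.
by case: (odd (h v)); rewrite // mulrC.
Qed.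

Lemma zero_layer2_mult :
  (forall v, (h v <= 1)%N -> o v != Some 0) -> (forall v, h v = 2%N -> o v = Some 0) ->
  #|[set v : 'I_n | h v == 2%N]|%:Z - #|[set v : 'I_n | h v == 3%N]|%:Z
    <= (mup t (char_poly A))%:Z.
Proof.
move=> z1 z2; rewrite -mult_zero_pole; apply: (zero_layer2 lay zero_not_pole) => //.
by move=> v /z2 ov; rewrite /z /= ov.
Qed.

End Values.

End TreeMatrix.

(** * Spectrum of a matrix with constant layers *)

(** Summation by parts in the exponents: [G k] occurs in every partial product with [i >= k], and
    its exponents telescope to [c k]. *)
Lemma prod_telescope (K : fieldType) (G : nat -> K) (c : nat -> nat) m :
  (forall k, (c k.+1 <= c k)%N) ->
  \prod_(0 <= i < m) (\prod_(0 <= k < i.+1) G k) ^+ (c i - c i.+1)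
    * (\prod_(0 <= k < m) G k) ^+ c m =
  \prod_(0 <= k < m) G k ^+ c k.
Proof.
move=> cS; elim: m => [|m IH]; first by rewrite !big_geq // expr1n mulr1.
rewrite big_nat_recr //= -mulrA -exprD subnK // big_nat_recr //= exprMn mulrA IH.
by rewrite -big_nat_recr.
Qed.

Section Spectrum.
Variables (R : realType) (a1 a2 b2 b3 b4 : R).
Variables (K : fieldType) (phi : {rmorphism {poly R} -> K}).
Local Notation ca := (Ca a1 a2 b2 b3 b4).
Local Notation cb := (Cb a1 a2 b2 b3 b4).

(** The pivots of [Cmx] eliminated from its last row upwards; they do not depend on the size, as the
    smaller matrices are trailing submatrices. *)
Fixpoint path_schur (k : nat) : K :=
  phi ('X - (ca k.+1)%:P) - (if k is k'.+1 then phi (cb k.+1)%:P / path_schur k' else 0).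

Lemma char_poly_Cmx m : (forall k, (k < m)%N -> path_schur k != 0) ->
  phi (char_poly (Cmx a1 a2 b2 b3 b4 m)) = \prod_(0 <= k < m) path_schur k.
Proof.
move=> G0; rewrite /char_poly -det_map_mx big_nat_rev big_mkord.
have CE x y : (map_mx phi (char_poly_mx (Cmx a1 a2 b2 b3 b4 m))) x y =
    phi ('X *+ (x == y) - (Cmx a1 a2 b2 b3 b4 m x y)%:P) by rewrite !mxE.
apply: (@det_forest _ _ (fun x y => x.+1 == y :> nat) val).
- by move=> x y /=; lia.
- by move=> x y z /eqP xz /eqP yz; apply: val_inj => /=; lia.
- move=> x y xy c1 c2; rewrite CE (negPf xy) mxE.
  rewrite -val_eqE /= in xy; rewrite (negPf xy) (negPf c1) (negPf c2) mulr0n subrr.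
  exact: rmorph0.
- by move=> x; apply: G0; have := ltn_ord x; lia.
move=> x; rewrite CE eqxx mulr1n mxE eqxx.
have xm := ltn_ord x; have -> : (0 + m - x.+1 = m - x.+1)%N by lia.
have [lt|ge] := ltnP x.+1 m; last first.
  have -> : (m - x.+1 = 0)%N by lia.
  have -> : (m - x = 1)%N by lia.
  by rewrite big1 //= => u /eqP xu; have := ltn_ord u; lia.
have -> : (m - x.+1 = (m - x.+2).+1)%N by lia.
have -> : (m - x = (m - x.+2).+2)%N by lia.
rewrite /=; congr (_ - _); rewrite (big_pred1 (Ordinal lt)) => [|u]; last first.
  by rewrite /= -val_eqE /= eq_sym.
rewrite !CE !mxE -!val_eqE /= eqxx.
have -> : (x == x.+1 :> nat) = false by lia.
have -> : (x.+1 == x :> nat) = false by lia.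
have -> : (x.+2 == x :> nat) = false by lia.
have -> : (m - x = (m - x.+2).+2)%N by lia.
rewrite !mulr0n !sub0r rmorphN rmorphN polyC1 rmorph1 mulrN1 opprK.
by have -> : (0 + m - x.+2 = m - x.+2)%N by lia.
Qed.

Variables (n : nat) (child : rel 'I_n) (h : 'I_n -> nat) (r : 'I_n).
Hypothesis lay : lush_layered child h r.
Variable A : 'M[R]_n.
Hypothesis A0 : forall x y, x != y -> ~~ child x y -> ~~ child y x -> A x y = 0.
Hypothesis Apos : forall v u, child v u -> 0 < A v u * A u v.
Hypothesis phi_inj : injective phi.
Hypothesis Aca : forall v, A v v = ca (h v).+1.
Hypothesis Acb : forall v, (0 < h v)%N ->
  \sum_(u | child v u) A v u * A u v = cb (h v).+1.

Lemma schur_path F : schur_recurrence child A phi F -> forall v, F v = path_schur (h v).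
Proof.
move=> FE; apply: (layered_ind lay) => v IH; rewrite FE Aca.
case hv: (h v) => [|k] /=; congr (_ - _).
  by rewrite big1 // => u /(layered_height lay); rewrite hv.
rewrite -hv -Acb ?hv // (raddf_sum polyC) rmorph_sum mulr_suml; apply: eq_bigr => u vu.
by rewrite IH //; have := layered_height lay vu; rewrite hv => -[<-].
Qed.

(** All vertices of height [k] share the pivot [path_schur k], and the first [i] pivots multiply to
    the characteristic polynomial of the path matrix of size [i]. *)
Lemma char_poly_layers :
  char_poly A = \prod_(1 <= i < (h r).+2) char_poly (Cmx a1 a2 b2 b3 b4 i) ^+
    (#|[set v | h v == i.-1]| - #|[set v | h v == i]|).
Proof.
apply: phi_inj; have [F FE] := schur_exists lay A phi.
have FG := schur_path FE.
have G0 k : (k <= h r)%N -> path_schur k != 0.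
  by move=> /(layered_nonempty lay) [v <-]; rewrite -FG (schur_neq0 lay Apos phi_inj FE).
rewrite (char_poly_schur lay A0 Apos phi_inj FE) (eq_bigr _ (fun v _ => FG v)).
rewrite (big_by_layer lay _ path_schur (ltnSn _)).
under eq_bigr do rewrite prodr_const.
rewrite -(@prod_telescope _ _ (fun k => #|[set v | h v == k]|)); last exact: layer_card_le lay.
rewrite (layer_empty lay) // expr0 mulr1 rmorph_prod big_add1 /=.
apply: eq_big_nat => i /andP[_ lt]; rewrite rmorphXn /= char_poly_Cmx // => k kl.
by apply: G0; lia.
Qed.

End Spectrum.

(** * The parameter region *)

Lemma mulr_gt0_signs (R : realDomainType) (x y : R) :
  0 < x * y -> (0 < x /\ 0 < y) \/ (x < 0 /\ y < 0).
Proof.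
case: (ltgtP x 0) => [x0|x0|->]; last by rewrite mul0r ltxx.
  by rewrite nmulr_rgt0 // => y0; right.
by rewrite pmulr_rgt0 // => y0; left.
Qed.

Lemma mulr_lt0_signs (R : realDomainType) (x y : R) :
  x * y < 0 -> (0 < x /\ y < 0) \/ (x < 0 /\ 0 < y).
Proof.
by rewrite -oppr_gt0 -mulrN => /mulr_gt0_signs [] []; rewrite ?oppr_gt0 ?oppr_lt0; tauto.
Qed.

(** Positivity of the three products leaves finitely many sign patterns of their factors; each is
    contradictory or implies one of the twelve alternatives. *)
Lemma inB_of_gt0 (R : realType) (a1 a2 b2 b3 b4 : R) :
  uniq [:: a1; a2; b2; b3; b4] ->
  0 < Cb a1 a2 b2 b3 b4 2 -> 0 < Cb a1 a2 b2 b3 b4 3 -> 0 < Cb a1 a2 b2 b3 b4 4 ->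
  inB a1 a2 b2 b3 b4.
Proof.
move=> U; rewrite /Cb /= => p2 p3 p4; split=> //.
have s2 := mulr_gt0_signs p2; have s3 := mulr_gt0_signs p3.
have s4 := mulr_gt0_signs p4; rewrite invr_gt0 invr_lt0 in s4.
case: s4 => -[] /[swap] s4; [move/mulr_gt0_signs|move/mulr_lt0_signs] => -[] [];
  [move/mulr_gt0_signs|move/mulr_lt0_signs|move/mulr_gt0_signs|move/mulr_lt0_signs]
    => -[] [] s5 s6 s7;
  case: s2 => -[] s8 s9; case: s3 => -[] s10 s11; clear p2 p3 p4;
  first [ exfalso; lra
        | by do 11?[first [left; do ![split]; lra | right]]; do ![split]; lra ].
Qed.

(** The two conditions make [b3] the largest or the smallest of the four numbers. Placing [b4]
    beyond it meets an alternative without a condition on sums. *)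
Lemma inB_extend (R : realType) (a1 a2 b2 b3 : R) : uniq [:: a1; a2; b2; b3] ->
  0 < (b2 - a1) * (a1 - a2) -> 0 < (b3 - a2) * (b3 - b2) ->
  exists b4, inB a1 a2 b2 b3 b4.
Proof.
move=> U p2 p3.
have inBx x : x \notin [:: a1; a2; b2; b3] -> uniq [:: a1; a2; b2; b3; x].
  by move=> xn; rewrite (rcons_uniq [:: a1; a2; b2; b3]) xn.
case: (mulr_gt0_signs p2) => -[s1 s2]; case: (mulr_gt0_signs p3) => -[s3 s4]; clear p2 p3;
  [exists (b3 + 1)|exists (b3 - 1)|exists (b3 + 1)|exists (b3 - 1)]; split;
  try (by apply: inBx; rewrite !inE !negb_or; apply/and4P; split; apply/eqP => E; lra);
  by do 11?[first [left; do ![split]; lra | right]]; do ![split]; lra.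
Qed.

(** * Rigidity of critical multiplicity lists *)

Lemma hgt_le (n : nat) (adj : rel 'I_n) (r v : 'I_n) : (hgt adj r v <= n)%N.
Proof. by rewrite /hgt; elim/big_rec: _ => // u m _; apply: leq_trans; exact: geq_minr. Qed.

(** Summation by parts over the layer sizes; the boundary layer is empty because heights are at most
    [n]. The index [b.+1] belongs to zeros at height [b]. *)
Lemma ell_sumE (n : nat) (adj : rel 'I_n) (r : 'I_n) (b p : nat) :
  lush_layered (is_child adj r) (hgt adj r) r -> (1 < p)%N ->
  (ell_sum adj r b.+1 p)%:Z = \sum_v layer_weight b p (hgt adj r v).
Proof.
move=> lay p1; have Hn : (hgt adj r r < n.+1)%N by rewrite ltnS hgt_le.
rewrite (big_by_layer lay _ (layer_weight b p) Hn) /ell_sum big_add1 /=.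
pose c k : int := #|[set v | hgt adj r v == k]|%:Z.
rewrite (eq_bigr (fun k => layer_weight b p k * c k)); last first.
  by move=> k _; rewrite sumr_const -mulr_natr natz.
have := sum_layer_weight c b n.+1 p1.
have -> : (if (b < n.+1)%N && (n.+1 == b.+1 %[mod p]) then c n.+1 else 0) = 0.
  by case: ifP => // _; rewrite /c (layer_empty lay).
rewrite subr0 => <-; rewrite -natz natr_sum.
have Emod k : (k.+1 == b.+1 %[mod p]) = (k == b %[mod p]).
  by rewrite -[k.+1]addn1 -[b.+1]addn1 eqn_modDr.
rewrite (eq_bigl _ _ Emod); apply: eq_bigr => k _.
by rewrite natz /ell /= -subzn // (layer_card_le lay).
Qed.

Section Critical.
Variables (R : realType) (n : nat) (adj : rel 'I_n) (r : 'I_n) (A : 'M[R]_n).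
Variables (a1 a2 b2 b3 b4 : R).
Hypothesis lushT : is_lush adj r.
Hypothesis H2 : (2 <= height adj r)%N.
Hypothesis AT : inRG adj A.
Hypothesis crit : critical_witness adj r A a1 a2 b2 b3 b4.
Local Notation child := (is_child adj r).
Local Notation h := (hgt adj r).
Let S v := \sum_(u | child v u) A v u * A u v.

Let lay : lush_layered child h r := lush_hedge_layered lushT H2.

Let A0 x y : x != y -> ~~ child x y -> ~~ child y x -> A x y = 0.
Proof.
move=> xy c1 c2; case: AT => /(_ x y xy) Axy _; apply/eqP/negPn/negP => /Axy.
by rewrite (lush_hedge_adjE lushT) (negPf c1) (negPf c2).
Qed.

Let Apos v u : child v u -> 0 < A v u * A u v.
Proof. by case: AT => _ + /andP[vu _]; apply. Qed.

Let S_gt0 v : (0 < h v)%N -> 0 < S v.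
Proof.
move=> /(layered_child lay) [u vu]; rewrite /S (bigD1 u) //=.
apply: ltr_pwDl; first exact: Apos.
by apply: sumr_ge0 => w /andP[/Apos/ltW].
Qed.

Let le_weight b p t : (1 < p)%N -> (ell_sum adj r b.+1 p <= mult t A)%N ->
  \sum_v layer_weight b p (h v) <= (mup t (char_poly A))%:Z.
Proof. by move=> p1; rewrite -(ell_sumE b lay p1) lez_nat. Qed.

Let neqs : [/\ a1 != a2, a1 != b2, a1 != b3 & a1 != b4] /\
  [/\ a2 != b2, a2 != b3, a2 != b4 & b2 != b3] /\ b2 != b4 /\ b3 != b4.
Proof.
case: crit => /= + _ _ _ _; rewrite !inE !negb_or andbT.
by case/and4P=> /and4P[-> -> -> ->] /and3P[-> -> ->] /andP[-> ->] ->.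
Qed.

(** At [a1] the even heights vanish and have only infinite children, so [a1 - A v v] must be 0
    there. *)
Lemma crit_alpha1 : mult a1 A = ell_sum adj r 1 2 /\
  forall v, ~~ odd (h v) -> A v v = a1.
Proof.
case: crit => _ m1 _ _ _; have [o oE] := leaf_to_root_exists lay A a1.
have [] := values2 lay A0 Apos oE (b := 0) isT H2 _ (le_weight _ m1) => // mE val.
split=> [|v ev]; first by apply/eqP; rewrite -eqz_nat (ell_sumE 0 lay) //; exact/eqP.
have : o v = Some (a1 - A v v).
  apply: (value_over_poles oE) => u /(layered_height lay) hv.
  by rewrite val // subn0; move: ev; rewrite hv /= negbK => ->.
by rewrite val // subn0 (negPf ev) => -[/esym/eqP]; rewrite subr_eq0 => /eqP.
Qed.

Let diag_even v : ~~ odd (h v) -> A v v = a1.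
Proof. by case: crit_alpha1 => _; apply. Qed.

Let value_leaf t o : leaf_to_root child A t o -> forall v, h v = 0%N -> o v = Some (t - a1).
Proof.
move=> oE v hv; rewrite (value_over_poles oE) ?diag_even ?hv //.
by move=> u /(layered_height lay); rewrite hv.
Qed.

Let value_leaf_neq0 t o : leaf_to_root child A t o -> a1 != t ->
  forall v, h v = 0%N -> o v != Some 0.
Proof.
move=> oE t1 v hv; rewrite (value_leaf oE hv); apply/eqP => -[/eqP].
by rewrite subr_eq0 eq_sym (negPf t1).
Qed.

Let value_height1 t o : leaf_to_root child A t o -> a1 != t ->
  forall v, h v = 1%N -> o v = Some (t - A v v - S v / (t - a1)).
Proof.
move=> oE t1 v hv; apply: (value_over_const oE); first by rewrite subr_eq0 eq_sym.
by move=> u /(layered_height lay) hu; apply: value_leaf; last lia.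
Qed.

(** The pattern starts at height 1, as leaves have value [a2 - a1]. From height 3 on, zeros lie over
    poles; at height 1 they lie over leaves, which yields only a relation between the sum and the
    diagonal entry. *)
Lemma crit_alpha2 : mult a2 A = ell_sum adj r 2 2 /\
  (forall v, (3 <= h v)%N -> odd (h v) -> A v v = a2) /\
  (forall v, h v = 1%N -> S v = (a2 - A v v) * (a2 - a1)).
Proof.
have [[a12 _ _ _] _] := neqs.
case: crit => _ _ m2 _ _; have [o oE] := leaf_to_root_exists lay A a2.
have o0 v : (h v < 1)%N -> o v != Some 0.
  by move=> hv; apply: (value_leaf_neq0 oE a12); lia.
have [mE val] := values2 lay A0 Apos oE (b := 1) isT H2 o0 (le_weight (isT : 1 < 2)%N m2).
split; first by apply/eqP; rewrite -eqz_nat (ell_sumE 1 lay) //; exact/eqP.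
split=> v hv.
  move=> od; have : o v = Some (a2 - A v v).
    apply: (value_over_poles oE) => u /(layered_height lay) hu.
    by rewrite val ?ifT //; lia.
  rewrite val ?ifF; [|lia|lia].
  by move=> -[/esym/eqP]; rewrite subr_eq0 => /eqP.
have := value_height1 oE a12 hv; rewrite val ?hv //= => -[/esym/eqP].
rewrite subr_eq0 => /eqP ->; rewrite divfK //.
by rewrite subr_eq0 eq_sym.
Qed.

Let diag_odd v : (3 <= h v)%N -> odd (h v) -> A v v = a2.
Proof. by have [_ [+ _]] := crit_alpha2; apply. Qed.

Let diag_high v : (2 <= h v)%N -> A v v = if odd (h v) then a2 else a1.
Proof.
move=> hv; case: ifP => od; last by rewrite diag_even ?od.
by rewrite diag_odd //; lia.
Qed.

Lemma crit_beta2 :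
  (forall v, h v = 1%N -> A v v = - a1 + a2 + b2 /\ S v = (b2 - a1) * (a1 - a2)) /\
  (forall v, (4 <= h v)%N -> ((h v - 1) %% 3 = 0)%N -> S v = (b2 - a1) * (b2 - a2)).
Proof.
have [[a12 a1b2 _ _] [[a2b2 _ _ _] _]] := neqs.
case: crit => _ _ _ [m _ _] _; have [o oE] := leaf_to_root_exists lay A b2.
have o0 v : (h v < 1)%N -> o v != Some 0.
  by move=> hv; apply: (value_leaf_neq0 oE a1b2); lia.
have bH : (1 <= 1 <= h r)%N by rewrite /= (ltnW H2).
have le := le_weight (isT : 1 < 3)%N m.
split; last first.
  exact: (weight_above_base lay A0 Apos oE bH o0 diag_high a1b2 a2b2 le).
have At w : (1 < h w)%N -> A w w != b2 by move=> /diag_high ->; case: ifP.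
move=> v hv; have := values3 lay A0 Apos oE bH o0 At le (v := v); rewrite hv => /(_ isT) /=.
rewrite (value_height1 oE a1b2 hv) => -[/eqP]; rewrite subr_eq0 => /eqP E.
have S1 : S v = (b2 - A v v) * (b2 - a1).
  by rewrite E divfK // subr_eq0 eq_sym.
have [_ [_ /(_ v hv) S2]] := crit_alpha2.
(* The conditions from [a2] and [b2] are two linear equations for [A v v] and [S v], independent
   since [a2 != b2]. *)
have AE : A v v = - a1 + a2 + b2.
  have d0 : a2 - b2 != 0 by rewrite subr_eq0.
  apply: (mulfI d0); apply/eqP; rewrite -subr_eq0.
  have -> : (a2 - b2) * A v v - (a2 - b2) * (- a1 + a2 + b2) =
     (b2 - A v v) * (b2 - a1) - (a2 - A v v) * (a2 - a1) by ring.
  by rewrite -S1 -S2 subrr.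
by split=> //; rewrite S1 AE; ring.
Qed.

(** The numerator is the characteristic polynomial of the path matrix of size 2, with roots [a2] and
    [b2]. *)
Let value_height1_const t o : leaf_to_root child A t o -> a1 != t ->
  forall v, h v = 1%N -> o v = Some ((t - a2) * (t - b2) / (t - a1)).
Proof.
move=> oE t1 v hv; rewrite (value_height1 oE t1 hv).
have [/(_ v hv) [-> ->] _] := crit_beta2; congr Some.
by field; rewrite subr_eq0 eq_sym.
Qed.

Let value_height2 t o : leaf_to_root child A t o -> a1 != t -> a2 != t -> b2 != t ->
  forall v, h v = 2%N -> o v = Some (t - a1 - S v / ((t - a2) * (t - b2) / (t - a1))).
Proof.
move=> oE t1 t2 t3 v hv; have c0 : (t - a2) * (t - b2) / (t - a1) != 0.
  by apply: mulf_neq0; [apply: mulf_neq0|rewrite invr_eq0]; rewrite subr_eq0 eq_sym.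
rewrite (value_over_const oE c0) ?diag_even ?hv // => u /(layered_height lay) hu.
by apply: value_height1_const => //; lia.
Qed.

Let value_low_neq0 t o : leaf_to_root child A t o -> a1 != t -> a2 != t -> b2 != t ->
  forall v, (h v < 2)%N -> o v != Some 0.
Proof.
move=> oE t1 t2 t3 v hv; have [h0|h0] := eqVneq (h v) 0%N.
  exact: (value_leaf_neq0 oE t1 h0).
rewrite (value_height1_const oE t1); last by lia.
apply/eqP => -[/eqP]; apply/negP.
by apply: mulf_neq0; [apply: mulf_neq0|rewrite invr_eq0]; rewrite subr_eq0 eq_sym.
Qed.

(** At [b3] nothing below height 2 vanishes, so the pattern starts there and its zeros determine the
    sums. *)
Lemma crit_beta3 :
  (forall v, h v = 2%N -> S v = (b3 - a2) * (b3 - b2)) /\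
  (forall v, (5 <= h v)%N -> ((h v - 2) %% 3 = 0)%N -> S v = (b3 - a1) * (b3 - a2)).
Proof.
have [[_ _ t1 _] [[_ t2 _ t3] _]] := neqs.
case: crit => _ _ _ [_ m _] _; have [o oE] := leaf_to_root_exists lay A b3.
have bH : (1 <= 2 <= h r)%N by [].
have o0 := value_low_neq0 oE t1 t2 t3.
have le := le_weight (isT : 1 < 3)%N m.
have Av v : (2 < h v)%N -> A v v = if odd (h v) then a2 else a1 by move/ltnW/diag_high.
have At w : (2 < h w)%N -> A w w != b3 by move=> /Av ->; case: ifP.
split; last exact: (weight_above_base lay A0 Apos oE bH o0 Av t1 t2 le).
move=> v hv; have := values3 lay A0 Apos oE bH o0 At le (v := v); rewrite hv => /(_ isT) /=.
rewrite (value_height2 oE t1 t2 t3 hv) => -[/eqP]; rewrite subr_eq0 => /eqP E.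
have d1 : b3 - a1 != 0 by rewrite subr_eq0 eq_sym.
have d2 : (b3 - a2) * (b3 - b2) / (b3 - a1) != 0.
  by apply: mulf_neq0; [apply: mulf_neq0|rewrite invr_eq0]; rewrite subr_eq0 eq_sym.
by rewrite -[LHS](divfK d2) -E mulrC divfK.
Qed.

(** The pattern starts at height 3 once the common value [g] at height 2 is nonzero; setting the
    value at height 3 to 0 then determines the sums. *)
Lemma crit_beta4 : (3 <= h r)%N ->
  (forall v, h v = 3%N ->
     S v = (b4 - a1) * (b3 - b4) * (a2 + b2 - b3 - b4) / (b4 - b2)) /\
  (forall v, (6 <= h v)%N -> ((h v - 3) %% 3 = 0)%N -> S v = (b4 - a1) * (b4 - a2)).
Proof.
move=> H3; have [[_ _ _ t1] [[_ _ t2 _] [t3 t4]]] := neqs.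
case: crit => _ _ _ [_ _ m] ml; have [o oE] := leaf_to_root_exists lay A b4.
have d1 : b4 - a1 != 0 by rewrite subr_eq0 eq_sym.
have d2 : b4 - a2 != 0 by rewrite subr_eq0 eq_sym.
have d3 : b4 - b2 != 0 by rewrite subr_eq0 eq_sym.
pose g := b4 - a1 - (b3 - a2) * (b3 - b2) / ((b4 - a2) * (b4 - b2) / (b4 - a1)).
have val2 v : h v = 2%N -> o v = Some g.
  by move=> hv; rewrite (value_height2 oE t1 t2 t3 hv); have [-> //] := crit_beta3.
have low := value_low_neq0 oE t1 t2 t3.
have g0 : g != 0.
  (* If [g] were 0, all of height 2 would vanish at [b4] and the multiplicity would be at least
     [ell adj r 3]. *)
  apply: contraTneq ml => gz; rewrite -leqNgt -lez_nat /ell /= -subzn ?(layer_card_le lay) //.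
  apply: (zero_layer2_mult lay A0 Apos oE); first by move=> v hv; apply: low.
  by move=> v /val2; rewrite gz.
have o0 v : (h v < 3)%N -> o v != Some 0.
  rewrite ltnS leq_eqVlt => /orP[/eqP/val2->|/low//].
  by apply/eqP => -[/eqP]; exact/negP.
have bH : (1 <= 3 <= h r)%N by [].
have le := le_weight (isT : 1 < 3)%N m.
have Av v : (3 < h v)%N -> A v v = if odd (h v) then a2 else a1.
  by move=> hv; apply: diag_high; lia.
have At w : (3 < h w)%N -> A w w != b4 by move=> /Av ->; case: ifP.
split; last exact: (weight_above_base lay A0 Apos oE bH o0 Av t1 t2 le).
move=> v hv; have := values3 lay A0 Apos oE bH o0 At le (v := v); rewrite hv => /(_ isT) /=.
rewrite (value_over_const oE g0) => [|u /(layered_height lay) hu]; last by apply: val2; lia.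
rewrite diag_odd ?hv // => -[/eqP]; rewrite subr_eq0 => /eqP E.
rewrite -[LHS](divfK g0) -E /g; field.
by rewrite d3 d1 d2.
Qed.

(** The last parameter first enters in the sums at height 3, so for height 2 it may be any
    number. *)
Lemma crit_entries d4 : ((3 <= h r)%N -> d4 = b4) ->
  (forall v, A v v = Ca a1 a2 b2 b3 d4 (h v).+1) /\
  (forall v, (0 < h v)%N -> S v = Cb a1 a2 b2 b3 d4 (h v).+1).
Proof.
move=> d4E; split=> v; rewrite ?/Ca ?/Cb.
  rewrite /=; case: (boolP (odd (h v))) => od /=; last by rewrite diag_even.
  have [h1|h1] := eqVneq (h v) 1%N; first by have [/(_ v h1) [-> _] _] := crit_beta2; rewrite h1.
  by rewrite ifF ?diag_odd //; lia.
move=> h0; have hr := layered_root lay v.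
have [h1|h1] := eqVneq (h v) 1%N; first by have [/(_ v h1) [_ ->] _] := crit_beta2; rewrite h1.
have [h2|h2] := eqVneq (h v) 2%N; first by have [/(_ v h2) -> _] := crit_beta3; rewrite h2.
have H3 : (3 <= h r)%N by lia.
have [h3|h3] := eqVneq (h v) 3%N.
  by have [/(_ v h3) -> _] := crit_beta4 H3; rewrite h3 /= d4E.
rewrite !ifF; [|lia|lia|lia].
have : [\/ (h v).+1 %% 3 = 0, (h v).+1 %% 3 = 1 | (h v).+1 %% 3 = 2]%N.
  have : ((h v).+1 %% 3 < 3)%N by rewrite ltn_pmod.
  by case: (_ %% _)%N => [|[|[|]]] // _; [apply: Or31|apply: Or32|apply: Or33].
case=> E; rewrite E /=.
- by have [_ SE] := crit_beta3; rewrite SE //; lia.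
- by rewrite d4E //; have [_ SE] := crit_beta4 H3; rewrite SE //; lia.
- by have [_ SE] := crit_beta2; rewrite SE //; lia.
Qed.

(** Each off-diagonal parameter up to the root is the sum [S v] at some vertex, hence positive. For
    height 2 a replacement of [b4] is chosen. *)
Lemma crit_region : exists2 d4, inB a1 a2 b2 b3 d4 & ((3 <= h r)%N -> d4 = b4).
Proof.
have gt0 d4 k : ((3 <= h r)%N -> d4 = b4) -> (0 < k <= h r)%N -> 0 < Cb a1 a2 b2 b3 d4 k.+1.
  move=> dE /andP[k0 /(layered_nonempty lay) [v hv]].
  by have [_ SE] := crit_entries dE; rewrite -hv -SE ?S_gt0 ?hv.
have U : uniq [:: a1; a2; b2; b3; b4] by case: crit.
have [H3|H3] := leqP 3 (h r).
  by exists b4 => //; apply: inB_of_gt0 => //; apply: gt0 => //; apply/andP; split=> //; lia.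
have dE : (3 <= h r)%N -> b4 = b4 by [].
have [|||d4 d4B] := @inB_extend R a1 a2 b2 b3; last by exists d4 => //; lia.
- by move: U; rewrite (rcons_uniq [:: a1; a2; b2; b3]) => /andP[].
- by have := gt0 b4 1%N dE; rewrite /Cb /=; apply; exact: ltnW H2.
- by have := gt0 b4 2%N dE; rewrite /Cb /=; apply.
Qed.

(** As the subdiagonal of [Cmx] is 1, its edge products are the superdiagonal entries, which are
    sums [S v] and so positive. *)
Lemma crit_inPH d4 : ((3 <= h r)%N -> d4 = b4) ->
  inPH adj r (Cmx a1 a2 b2 b3 d4 (height adj r).+1) A.
Proof.
move=> dE; have [AE SE] := crit_entries dE.
have hH v : (h v <= height adj r)%N by exact: layered_root lay v.
set H := height adj r in hH *.
have CE (k l : 'I_H.+1) : k.+1 = l -> 0 < Cb a1 a2 b2 b3 d4 (H.+1 - k).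
  move=> kl; have lH := ltn_ord l.
  have [v hv] : exists v, h v = (H - k)%N by apply: (layered_nonempty lay); exact: leq_subr.
  have -> : (H.+1 - k = (h v).+1)%N by lia.
  by rewrite -SE ?S_gt0; lia.
have adjC (k l : 'I_H.+1) : path_adj k l ->
    0 < Cmx a1 a2 b2 b3 d4 H.+1 k l * Cmx a1 a2 b2 b3 d4 H.+1 l k.
  rewrite /path_adj !mxE => /orP[] /eqP kl.
    have -> : (k == l :> nat) = false by lia.
    have -> : (l == k :> nat) = false by lia.
    have -> : (k.+1 == l :> nat) by lia.
    have -> : (l.+1 == k :> nat) = false by lia.
    by rewrite mulr1 (CE _ _ kl).
  have -> : (k == l :> nat) = false by lia.
  have -> : (l == k :> nat) = false by lia.
  have -> : (l.+1 == k :> nat) by lia.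
  have -> : (k.+1 == l :> nat) = false by lia.
  by rewrite mul1r (CE _ _ kl).
split=> // [|v|v].
- split=> // k l kl; split=> [|/adjC]; last by case: eqP => // ->; rewrite mul0r ltxx.
  rewrite mxE /path_adj -val_eqE /= in kl *; rewrite (negPf kl).
  by case: ifP => //= _; case: ifP => //= _; rewrite eqxx.
- rewrite mxE eqxx inordK ?AE; last by lia.
  by congr (Ca _ _ _ _ _ _); have := hH v; lia.
rewrite (lush_hedge_leafE lushT) // -lt0n => h0; rewrite -/(S v) SE //.
have := hH v => hv.
rewrite !mxE !inordK; [|lia|lia].
have -> : (H - h v == (H - h v).+1 :> nat)%N = false by lia.
have -> : ((H - h v).+1 == H - h v :> nat)%N = false by lia.
have -> : ((H - h v).+2 == H - h v :> nat)%N = false by lia.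
rewrite !eqxx mulr1; congr (Cb _ _ _ _ _ _); lia.
Qed.

Lemma crit_char_poly d4 : ((3 <= h r)%N -> d4 = b4) ->
  char_poly A = \prod_(1 <= i < (height adj r).+2)
             char_poly (Cmx a1 a2 b2 b3 d4 i) ^+ ell adj r i.
Proof.
move=> dE; have [AE SE] := crit_entries dE.
pose phi : {rmorphism {poly R} -> {fraction {poly R}}} := @tofrac _.
have phi_inj : injective phi by move=> p q /eqP; rewrite tofrac_eq => /eqP.
exact: (char_poly_layers lay A0 Apos phi_inj AE SE).
Qed.

End Critical.

(** The multiset identity for the spectrum is expressed as a factorisation of characteristic
    polynomials; symmetric matrices are covered since [inSG] contains [inRG]. *)
Theorem mainTheorem15 (R : realType) (n : nat) (adj : rel 'I_n) (r : 'I_n)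
    (A : 'M[R]_n) (a1 a2 b2 b3 b4 : R) :
  is_lush adj r ->
  (2 <= height adj r)%N ->
  inRG adj A ->
  critical_witness adj r A a1 a2 b2 b3 b4 ->
  exists (c1 c2 d2 d3 d4 : R),
    [/\ inB c1 c2 d2 d3 d4,
        inPH adj r (Cmx c1 c2 d2 d3 d4 (height adj r).+1) A,
        char_poly A =
          \prod_(1 <= i < (height adj r).+2)
             char_poly (Cmx c1 c2 d2 d3 d4 i) ^+ ell adj r i,
        mult a1 A = ell_sum adj r 1 2
      & mult a2 A = ell_sum adj r 2 2].
Proof.
move=> lushT H2 AT crit.
have [d4 d4B dE] := crit_region lushT H2 AT crit.
(* The witnesses themselves serve as parameters, except that [d4] may differ from [b4] when the
   height is 2. *)
exists a1, a2, b2, b3, d4; split=> //.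
- exact: (crit_inPH lushT H2 AT crit dE).
- exact: (crit_char_poly lushT H2 AT crit dE).
- by have [] := crit_alpha1 lushT H2 AT crit.
by have [] := crit_alpha2 lushT H2 AT crit.
Qed.
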